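(* Let $b>0$ and let $f\in C^2[-b,b]$ be complex-valued with $f(x)\ne0$ on $[-b,b]$ and $f(0)=1$. Let $\mathbf{K}_f$ and $\mathbf{K}_{1/f}$ be the integral kernels on $[-b,b]\times[-b,b]$ defined in the context. Then the bicomplex-valued function $$\mathbf{K}=\mathbf{K}_f-\mathbf{j}\,\mathbf{K}_{1/f}$$ of $(x,t)$ is a solution of the hyperbolic Vekua equation $$\partial_{\bar z}\mathbf{K}-\frac{f'(x)}{2f(x)}\overline{\mathbf{K}}=0 .$$
   Context: Bicomplex numbers: $\mathbb{B}=\{u+v\mathbf{j}:u,v\in\mathbb{C}\}$, $\mathbf{j}^2=1$, the complex unit commuting with $\mathbf{j}$; $\overline{u+v\mathbf{j}}=u-v\mathbf{j}$; $z=x+t\mathbf{j}$, $\partial_{\bar z}=\frac12(\partial_x-\mathbf{j}\partial_t)$. For a complex-valued $q\in C[-b,b]$ and $h\in\mathbb{C}$, let $\mathbf{H}(u,v;h)$ be the unique solution, on $\{(u,v):|u|\le b,|v|\le b,|u+v|\le b\}$, of the Goursat problem $$\frac{\partial^2\mathbf{H}(u,v;h)}{\partial u\,\partial v}=q(u+v)\mathbf{H}(u,v;h),\qquad \mathbf{H}(u,0;h)=\frac h2+\frac12\int_0^uq(s)\,ds,\qquad \mathbf{H}(0,v;h)=\frac h2,$$ and let $\mathbf{K}(x,t;h)=\mathbf{H}\bigl(\frac{x+t}2,\frac{x-t}2;h\bigr)$ for $(x,t)\in[-b,b]^2$. $\mathbf{K}_f$ is $\mathbf{K}(\cdot,\cdot;f'(0))$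 for the potential $q=q_f:=f''/f$; $\mathbf{K}_{1/f}$ is $\mathbf{K}(\cdot,\cdot;-f'(0))$ for the potential $q=q_{1/f}:=-q_f+2(f'/f)^2$. *)

(* Defs.v *)
From Stdlib Require Import Reals.
From Coquelicot Require Import Coquelicot.

Open Scope R_scope.

(* [is_derive] relative to a subset [D] of the line: at an end point of an
   interval this is the one-sided derivative.  When [D] is a nondegenerate
   interval containing [x], the derivative [l] is unique. *)
Definition is_derive_on {V : NormedModule R_AbsRing}
    (D : R -> Prop) (f : R -> V) (x : R) (l : V) : Prop :=
  filterdiff f (within D (locally x)) (fun h : R => scal h l).

Definition segment (b x : R) : Prop := Rabs x <= b.

Definition square (b x t : R) : Prop := Rabs x <= b /\ Rabs t <= b.

Definition hexagon (b u v : R) : Prop :=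
  Rabs u <= b /\ Rabs v <= b /\ Rabs (u + v) <= b.

(* Coquelicot's canonical structure on [C] is that of a module over itself, so
   real derivatives and integrals must name the real structure. *)

(* [f] is in C^2[-b,b], with first derivative [f'] and second derivative [f'']. *)
Definition C2_on (b : R) (f f' f'' : R -> C) : Prop :=
  (forall x, segment b x ->
     is_derive_on (V := C_R_NormedModule) (segment b) f x (f' x) /\
     is_derive_on (V := C_R_NormedModule) (segment b) f' x (f'' x)) /\
  continuous_on (T := R_UniformSpace) (U := C_R_NormedModule) (segment b) f''.

(* The potentials f''/f and (1/f)''/(1/f) = - f''/f + 2 (f'/f)^2. *)
Definition q_of (f f'' : R -> C) (x : R) : C := (f'' x / f x)%C.
Definition q_of_inv (f f' f'' : R -> C) (x : R) : C :=
  (- q_of f f'' x + 2 * ((f' x / f x) * (f' x / f x)))%C.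

(* The regularity asked for is minimal: [H] is continuous, and the iterated
   derivative d/du (dH/dv) exists; it already makes the solution unique on
   the hexagon.  Nothing is said about [H] off the hexagon. *)
Definition goursat_solution (b : R) (q : R -> C) (h : C) (H : R -> R -> C) : Prop :=
  continuous_on (T := prod_UniformSpace R_UniformSpace R_UniformSpace)
    (U := C_R_NormedModule)
    (fun p => hexagon b (fst p) (snd p)) (fun p => H (fst p) (snd p)) /\
  (exists Hv : R -> R -> C,
     forall u v, hexagon b u v ->
       is_derive_on (V := C_R_NormedModule)
         (fun s => hexagon b u s) (fun s => H u s) v (Hv u v) /\
       is_derive_on (V := C_R_NormedModule)
         (fun s => hexagon b s v) (fun s => Hv s v) u (q (u + v)%R * H u v)%C) /\
  (forall u, segment b u ->
     H u 0 = (h / 2 + / 2 * RInt (V := C_R_CompleteNormedModule) q 0 u)%C) /\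
  (forall v, segment b v -> H 0 v = (h / 2)%C).

Definition kernel (H : R -> R -> C) (x t : R) : C := H ((x + t) / 2) ((x - t) / 2).

(* The pair [(u, v)] stands for the bicomplex number u + v j, where j^2 = 1. *)
Definition Bicomplex : Type := (C * C)%type.

Definition Bicomplex_R_NormedModule : NormedModule R_AbsRing :=
  prod_NormedModule R_AbsRing C_R_NormedModule C_R_NormedModule.

Definition CtoB (u : C) : Bicomplex := (u, RtoC 0).
Definition Bj : Bicomplex := (RtoC 0, RtoC 1).
Definition Bminus (w z : Bicomplex) : Bicomplex :=
  ((fst w - fst z)%C, (snd w - snd z)%C).
Definition Bmult (w z : Bicomplex) : Bicomplex :=
  ((fst w * fst z + snd w * snd z)%C, (fst w * snd z + snd w * fst z)%C).
Definition Bconj (w : Bicomplex) : Bicomplex := (fst w, (- snd w)%C).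

(* The operator d/d(zbar) = 1/2 (d/dx - j d/dt), as a function of the values
   [Wx], [Wt] of the two partial derivatives. *)
Definition dbar (Wx Wt : Bicomplex) : Bicomplex :=
  Bmult (CtoB (/ 2)%C) (Bminus Wx (Bmult Bj Wt)).

(* Classical (C^1) solutions on the closed square of
   d W / d(zbar) - a(x) conj(W) = 0. *)
Definition vekua_solution (b : R) (a : R -> C) (W : R -> R -> Bicomplex) : Prop :=
  exists Wx Wt : R -> R -> Bicomplex,
    continuous_on (T := prod_UniformSpace R_UniformSpace R_UniformSpace)
      (U := Bicomplex_R_NormedModule)
      (fun p => square b (fst p) (snd p)) (fun p => Wx (fst p) (snd p)) /\
    continuous_on (T := prod_UniformSpace R_UniformSpace R_UniformSpace)
      (U := Bicomplex_R_NormedModule)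
      (fun p => square b (fst p) (snd p)) (fun p => Wt (fst p) (snd p)) /\
    forall x t, square b x t ->
      is_derive_on (V := Bicomplex_R_NormedModule)
        (segment b) (fun s => W s t) x (Wx x t) /\
      is_derive_on (V := Bicomplex_R_NormedModule)
        (segment b) (fun s => W x s) t (Wt x t) /\
      Bminus (dbar (Wx x t) (Wt x t)) (Bmult (CtoB (a x)) (Bconj (W x t))) =
        CtoB (RtoC 0).

(* Main.v *)
Require Import Defs.
From Stdlib Require Import Reals Factorial Lra.
From Coquelicot Require Import Coquelicot.

(** Write p = f'/f, and let H and G solve the Goursat problems for the potentials
    p' + p^2 (= f''/f) and - p' + p^2.  In the characteristic coordinates
    u = (x + t)/2, v = (x - t)/2 the Vekua equation for K_f - j K_{1/f} is a pair
    of complex equations, whose sum and difference are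
<<
      S_u = p(u + v) D,    D_v = p(u + v) S,    where S = H + G, D = H - G.
>>
    To verify them one studies the defects, multiplied by f to keep derivatives
    of p out of the computation:
<<
      E = f S_u - f' D,    F = f D_v - f' S.
>>
    The two Goursat equations H_uv = (p' + p^2) H, G_uv = (- p' + p^2) G give
<<
      E_v = p (E - F),     F_u = p (F - E),
>>
    and the initial data give E(u, 0) = 0 and F(0, v) = 0, the former because
    f D - f' solves a linear equation along the axis v = 0.  This is again a
    Goursat problem, linear and homogeneous, and iterating its integral form
    bounds E and F by B (2 M r)^n / n! with r = |u| + |v|, for every n; so E = F = 0
    ([Goursat_system_zero], [characteristic_system]).

    Two points of regularity need work.  A Goursat solution is only supposed to
    have the iterated derivative d/du (dH/dv), while the argument uses H_u and
    d/dv (H_u).  And all derivatives are taken relative to closed sets.  Both are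
    settled by the integral representation
<<
      H(u, v) = h/2 + 1/2 int_0^u q + int_0^v int_0^u q(s + w) H(s, w) ds dw.
>>
    Since (x, t) in the square means |u| + |v| <= b, only this diamond matters.
    On it the integrands may be replaced by continuous functions on the whole
    plane, obtained by clamping x = s + w and t = s - w to [-b, b]; the right-hand
    side then defines a C^1 function on the plane which coincides with H on the
    diamond ([Goursat_extension_exists]).  Together with a similar extension of f
    this leaves only ordinary two-sided derivatives to compute with. *)

(** * Clamping, and derivatives relative to a subset of the line *)

Definition clamp (b x : R) : R := Rmax (- b) (Rmin b x).

Lemma clamp_segment (b x : R) : 0 < b -> segment b (clamp b x).
Proof.
  intros Hb. unfold segment, clamp. apply Rabs_le.
  unfold Rmax, Rmin. repeat destruct Rle_dec; lra.
Qed.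

Lemma clamp_id (b x : R) : segment b x -> clamp b x = x.
Proof.
  unfold segment, clamp. intros H%Rabs_le_between.
  rewrite Rmin_right by lra. apply Rmax_right; lra.
Qed.

Lemma clamp_continuous (b x : R) : continuous (clamp b) x.
Proof.
  apply continuity_pt_filterlim. intros eps Heps.
  exists eps. split; [exact Heps|]. intros y [_ Hy].
  apply Rle_lt_trans with (2 := Hy). simpl. unfold R_dist, clamp.
  unfold Rmax, Rmin, Rabs.
  repeat destruct Rle_dec; repeat destruct Rcase_abs; lra.
Qed.

Lemma continuous_on_comp {X T U : UniformSpace} (D : T -> Prop) (g : T -> U)
    (r : X -> T) (x : X) :
  continuous_on D g -> (forall y, D (r y)) -> continuous r x ->
  continuous (fun y => g (r y)) x.
Proof.
  intros Hg Dr Hr P HP. specialize (Hg (r x) (Dr x) P HP).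
  unfold within, filtermap in *. specialize (Hr _ Hg).
  unfold filtermap in Hr. revert Hr. apply filter_imp. auto.
Qed.

(** The bound at the base point itself, freed from the filters of [filterdiff]. *)
Lemma is_derive_on_domin {V : NormedModule R_AbsRing} (D : R -> Prop)
    (g : R -> V) (x : R) (l : V) :
  is_derive_on D g x l -> forall eps : posreal, exists delta : posreal,
  forall y, D y -> Rabs (y - x) < delta ->
    norm (minus (minus (g y) (g x)) (scal (y - x) l)) <= eps * Rabs (y - x).
Proof.
  intros [_ H] eps.
  destruct (H x (filter_le_within D) eps) as [d Hd].
  exists d. intros y Dy Hy. exact (Hd y Hy Dy).
Qed.

(** Two-sided derivatives of an extension restrict to relative derivatives. This
    is how every relative derivative of the conclusion is produced. *)
Lemma is_derive_is_derive_on {V : NormedModule R_AbsRing} (D : R -> Prop)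
    (g k : R -> V) (x : R) (l : V) :
  D x -> (forall y, D y -> g y = k y) -> is_derive g x l ->
  is_derive_on D k x l.
Proof.
  intros Dx Hgk H. unfold is_derive_on.
  assert (PF : ProperFilter (within D (locally x))).
  { split; [|apply within_filter, locally_filter].
    intros P [d Hd]. exists x. apply Hd; [apply ball_center|exact Dx]. }
  apply (filterdiff_ext_loc g).
  - exists (mkposreal _ Rlt_0_1). intros y _ Dy. now apply Hgk.
  - intros y Hy.
    replace y with x by (apply (is_filter_lim_unique _ _ (filter_le_within D) Hy)).
    now apply Hgk.
  - apply (filterdiff_locally _ x); [apply filter_le_within|exact H].
Qed.

(** Composing [phi] with the clamping [r] onto the interval turns relative
    derivatives into two-sided ones: [r] is 1-Lipschitz, so an increment of
    [phi o r] that is small compared with that of [r] is small compared with that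
    of the variable. The mean value theorem then applies to [phi o r]. *)
Lemma derive_on_0_const {V : NormedModule R_AbsRing} (D : R -> Prop)
    (phi : R -> V) (x0 x1 : R) :
  (forall x, Rmin x0 x1 <= x <= Rmax x0 x1 -> D x /\ is_derive_on D phi x zero) ->
  phi x0 = phi x1.
Proof.
  set (a := Rmin x0 x1). set (c := Rmax x0 x1). intros H.
  assert (Hac : a <= c) by apply Rminmax.
  set (r := fun x => Rmax a (Rmin c x)).
  assert (rin : forall x, a <= r x <= c).
  { intros x. unfold r, Rmax, Rmin; repeat destruct Rle_dec; lra. }
  assert (rid : forall x, a <= x <= c -> r x = x).
  { intros x Hx. unfold r. rewrite Rmin_right by lra. apply Rmax_right; lra. }
  assert (rlip : forall x y, Rabs (r y - r x) <= Rabs (y - x)).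
  { intros x y. unfold r, Rmax, Rmin, Rabs.
    repeat destruct Rle_dec; repeat destruct Rcase_abs; lra. }
  assert (Hder : forall x, a <= x <= c -> is_derive (fun y => phi (r y)) x zero).
  { intros x Hx. split; [exact (is_linear_scal_l (V := _) _)|].
    intros y Hy eps. rewrite <- (is_filter_lim_locally_unique x y Hy). clear y Hy.
    destruct (is_derive_on_domin _ _ _ _ (proj2 (H x Hx)) eps) as [d Hd].
    exists d. intros y Hy. change (Rabs (y - x) < d) in Hy.
    assert (Hl := rlip x y). rewrite (rid x Hx) in Hl |- *.
    specialize (Hd (r y) (proj1 (H _ (rin y))) ltac:(lra)).
    assert (Hz : forall w : R, scal w (zero : V) = zero) by (intros w; exact (scal_zero_r w)).
    rewrite Hz in Hd. rewrite Hz.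
    eapply Rle_trans; [exact Hd|].
    apply Rmult_le_compat_l; [apply Rlt_le, eps|exact Hl]. }
  assert (Hend : phi a = phi c).
  { destruct (Rle_lt_or_eq_dec a c Hac) as [Hlt| ->]; [|reflexivity].
    rewrite <- (rid a), <- (rid c) by lra.
    exact (eq_is_derive (fun y => phi (r y)) a c Hder Hlt). }
  unfold a, c, Rmin, Rmax in Hend. destruct Rle_dec; congruence.
Qed.

(** A substitute for the fundamental theorem of calculus when [g] is only
    differentiable relative to [D]: [k] will be an explicit integral. *)
Lemma derive_on_eq {V : NormedModule R_AbsRing} (D : R -> Prop)
    (g k d : R -> V) (x0 x1 : R) :
  (forall x, Rmin x0 x1 <= x <= Rmax x0 x1 ->
     D x /\ is_derive_on D g x (d x) /\ is_derive k x (d x)) ->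
  g x0 = k x0 -> g x1 = k x1.
Proof.
  intros H H0.
  assert (Hd : minus (g x0) (k x0) = minus (g x1) (k x1)).
  { apply (derive_on_0_const D (fun x => minus (g x) (k x))).
    intros x Hx. destruct (H x Hx) as (Dx & Hg & Hk). split; [exact Dx|].
    assert (Hk' := is_derive_is_derive_on D k k x _ Dx (fun _ _ => eq_refl) Hk).
    assert (F : Filter (within D (locally x))) by apply within_filter, locally_filter.
    apply (filterdiff_ext_lin _ _ _ (filterdiff_minus_fct _ _ _ _ Hg Hk')).
    intros y. transitivity (zero : V);
      [exact (minus_eq_zero (scal (y : R) (d x) : V))|symmetry; exact (scal_zero_r (y : R))]. }
  rewrite H0 in Hd.
  transitivity (plus (minus (g x1) (k x1)) (k x1) : V).
  - unfold minus. rewrite <- plus_assoc, plus_opp_l. symmetry. exact (plus_zero_r (g x1)).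
  - rewrite <- Hd. transitivity (plus zero (k x1) : V); [|exact (plus_zero_l (k x1))].
    f_equal. exact (minus_eq_zero (k x0)).
Qed.

(** Uniqueness of a relative derivative, for a constant function: each point of
    the segment has other points of the segment arbitrarily close to it. *)
Lemma is_derive_on_const_unique {V : NormedModule R_AbsRing} (b : R) (D : R -> Prop)
    (g : R -> V) (c l : V) (x : R) :
  0 < b -> segment b x -> (forall y, segment b y -> D y /\ g y = c) ->
  is_derive_on D g x l -> l = zero.
Proof.
  intros Hb Hx Hc H. apply norm_eq_zero.
  apply Rle_antisym; [|apply norm_ge_0]. apply le_epsilon. intros eps Heps.
  destruct (is_derive_on_domin _ _ _ _ H (mkposreal _ Heps)) as [d Hd]. simpl in Hd.
  assert (Hm : 0 < Rmin (d / 2) b) by (apply Rmin_glb_lt; [apply is_pos_div_2|exact Hb]).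
  assert (Hm1 := Rmin_l (d / 2) b). assert (Hm2 := Rmin_r (d / 2) b).
  assert (Hd0 := cond_pos d).
  assert (Hy : exists y, segment b y /\ 0 < Rabs (y - x) < d).
  { unfold segment in *. apply Rabs_le_between in Hx.
    destruct (Rle_dec 0 x) as [Hx0|Hx0].
    - exists (x - Rmin (d / 2) b). split; [apply Rabs_le_between; lra|].
      replace (_ - _ - _) with (- Rmin (d / 2) b) by ring.
      rewrite Rabs_Ropp, Rabs_pos_eq; lra.
    - exists (x + Rmin (d / 2) b). split; [apply Rabs_le_between; lra|].
      replace (_ + _ - _) with (Rmin (d / 2) b) by ring.
      rewrite Rabs_pos_eq; lra. }
  destruct Hy as (y & Hy & Hyx & Hyd).
  specialize (Hd y (proj1 (Hc y Hy)) Hyd).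
  rewrite (proj2 (Hc y Hy)), (proj2 (Hc x Hx)) in Hd.
  rewrite minus_eq_zero in Hd. unfold minus in Hd. rewrite plus_zero_l, norm_opp in Hd.
  assert (Hl : l = scal (/ (y - x)) (scal (y - x) l)).
  { assert (Hone : mult (/ (y - x)) (y - x) = one).
    { apply Rinv_l. intros E. rewrite E, Rabs_R0 in Hyx. lra. }
    rewrite scal_assoc, Hone. symmetry. exact (scal_one l). }
  rewrite Rplus_0_l, Hl.
  eapply Rle_trans; [exact (norm_scal (/ (y - x) : R_AbsRing) (scal (y - x) l))|].
  change (abs (/ (y - x))) with (Rabs (/ (y - x))). rewrite Rabs_inv.
  apply (Rmult_le_reg_l (Rabs (y - x))); [exact Hyx|].
  rewrite <- Rmult_assoc, Rinv_r, Rmult_1_l by lra. lra.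
Qed.

(** * Real double integrals with variable bounds *)

Lemma continuous_2d_section_l (g : R -> R -> R) (x y : R) :
  continuity_2d_pt g x y -> continuous (fun s => g s y) x.
Proof.
  intros H. apply continuity_pt_filterlim. intros eps Heps.
  destruct (H (mkposreal _ Heps)) as [d Hd]. exists d. split; [apply d|].
  intros s [_ Hs]. apply Hd; [exact Hs|]. rewrite Rminus_diag, Rabs_R0. apply d.
Qed.

Lemma continuous_2d_section_r (g : R -> R -> R) (x y : R) :
  continuity_2d_pt g x y -> continuous (fun w => g x w) y.
Proof.
  intros H. apply continuity_pt_filterlim. intros eps Heps.
  destruct (H (mkposreal _ Heps)) as [d Hd]. exists d. split; [apply d|].
  intros s [_ Hs]. apply Hd; [|exact Hs]. rewrite Rminus_diag, Rabs_R0. apply d.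
Qed.

Lemma continuity_2d_swap (g : R -> R -> R) (x y : R) :
  continuity_2d_pt g x y -> continuity_2d_pt (fun u v => g v u) y x.
Proof.
  intros H eps. destruct (H eps) as [d Hd]. exists d. intros u v Hu Hv. now apply Hd.
Qed.

Lemma is_RInt_cont (g : R -> R) (a b : R) :
  (forall x, continuous g x) -> is_RInt g a b (RInt g a b).
Proof.
  intros H. apply (RInt_correct (V := R_CompleteNormedModule)).
  apply (ex_RInt_continuous (V := R_CompleteNormedModule)). auto.
Qed.

Lemma is_derive_RInt_0 (g : R -> R) (x : R) :
  (forall x, continuous g x) -> is_derive (fun u => RInt g 0 u) x (g x).
Proof.
  intros H. apply (is_derive_RInt (V := R_NormedModule) g _ 0); [|apply H].
  apply filter_forall. intros u. now apply is_RInt_cont.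
Qed.

(** The change of the integrand is controlled by uniform continuity on a compact
    strip, the change of the upper bound by one-variable continuity. *)
Lemma continuity_2d_RInt (g : R -> R -> R) (x y : R) :
  (forall x y, continuity_2d_pt g x y) ->
  continuity_2d_pt (fun u w => RInt (fun s => g s w) 0 u) x y.
Proof.
  intros g_cont.
  assert (gl : forall w s, continuous (fun s => g s w) s).
  { intros w s. apply continuous_2d_section_l, g_cont. }
  intros eps. set (m := Rabs x + 1).
  assert (Hm : 0 < m) by (unfold m; assert (H := Rabs_pos x); lra).
  assert (He : 0 < eps / (2 * m)) by (apply Rdiv_lt_0_compat; [apply eps|lra]).
  destruct (uniform_continuity_2d_1d g (- m) m y (fun s _ => g_cont s y) (mkposreal _ He))
    as [d1 H1]. simpl in H1.
  destruct (proj1 (filterlim_locally _ _)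
    (ex_derive_continuous _ _ (ex_intro _ _ (is_derive_RInt_0 _ x (gl y))))
    (pos_div_2 eps)) as [d2 H2].
  (* the 1 keeps the upper bound [u] inside [-m, m], where [d1] is uniform *)
  assert (Hd : 0 < Rmin 1 (Rmin d1 d2)).
  { repeat apply Rmin_glb_lt; [lra|apply d1|apply d2]. }
  exists (mkposreal _ Hd). simpl. intros u w Hu Hw.
  assert (M1 := Rmin_l 1 (Rmin d1 d2)). assert (M2 := Rmin_r 1 (Rmin d1 d2)).
  assert (M3 := Rmin_l d1 d2). assert (M4 := Rmin_r d1 d2).
  assert (Hum : Rabs u <= m).
  { unfold m. replace u with (x + (u - x)) by ring. eapply Rle_trans; [apply Rabs_triang|]. lra. }
  assert (Hu2 : Rabs (u - x) < d2) by lra.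
  specialize (H2 u Hu2).
  change (Rabs (RInt (fun s => g s y) 0 u - RInt (fun s => g s y) 0 x) < eps / 2) in H2.
  assert (H3 : Rabs (RInt (fun s => g s w) 0 u - RInt (fun s => g s y) 0 u) <= eps / 2).
  { eapply Rle_trans.
    - apply (norm_RInt_le_const_abs (V := R_NormedModule) (fun s => minus (g s w) (g s y)) 0 u
        _ (eps / (2 * m))).
      + intros s Hs. apply Rlt_le.
        apply Rabs_le_between in Hum.
        assert (Hs' : - m <= s <= m).
        { unfold Rmin, Rmax in Hs; destruct Rle_dec; lra. }
        assert (Hd1 := cond_pos d1). apply Rabs_lt_between in Hw.
        apply H1; try lra. rewrite Rminus_diag, Rabs_R0. apply d1.
      + apply (is_RInt_minus (V := R_NormedModule)); apply is_RInt_cont; apply gl.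
    - rewrite Rminus_0_r. apply Rle_trans with (m * (eps / (2 * m))).
      + apply Rmult_le_compat_r; [now apply Rlt_le|exact Hum].
      + apply Req_le. field. lra. }
  replace (RInt (fun s => g s w) 0 u - RInt (fun s => g s y) 0 x) with
    ((RInt (fun s => g s w) 0 u - RInt (fun s => g s y) 0 u) +
     (RInt (fun s => g s y) 0 u - RInt (fun s => g s y) 0 x)) by ring.
  eapply Rle_lt_trans; [apply Rabs_triang|]. lra.
Qed.

(** The derivative in [y] is the fundamental theorem, that in [x] is
    differentiation under the integral sign; total differentiability follows
    because one of the two is jointly continuous. *)
Lemma differentiable_double_RInt (g : R -> R -> R) (x y : R) :
  (forall x y, continuity_2d_pt g x y) ->
  differentiable_pt_lim (fun u v => RInt (fun w => RInt (fun s => g s w) 0 u) 0 v) x y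
    (RInt (fun w => g x w) 0 y) (RInt (fun s => g s y) 0 x).
Proof.
  intros Hg.
  assert (HI := fun x y => continuity_2d_RInt g x y Hg).
  assert (Hd : forall u w, is_derive (fun u => RInt (fun s => g s w) 0 u) u (g u w)).
  { intros u w. apply (is_derive_RInt_0 (fun s => g s w)).
    intros s. apply continuous_2d_section_l, Hg. }
  assert (Hx : forall v u, is_derive (fun u => RInt (fun w => RInt (fun s => g s w) 0 u) 0 v) u
     (RInt (fun w => g u w) 0 v)).
  { intros v u.
    rewrite <- (RInt_ext (fun w => Derive (fun u => RInt (fun s => g s w) 0 u) u)).
    2: { intros w _. now apply is_derive_unique. }
    apply (is_derive_RInt_param (fun u w => RInt (fun s => g s w) 0 u)).
    - apply filter_forall. intros u' w _. eexists. apply Hd.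
    - intros w _. apply (continuity_2d_pt_ext g); [|apply Hg].
      intros u' w'. symmetry. now apply is_derive_unique.
    - apply filter_forall. intros u'.
      apply (ex_RInt_continuous (V := R_CompleteNormedModule)).
      intros w _. exact (continuous_2d_section_r _ u' w (HI u' w)). }
  apply filterdiff_differentiable_pt_lim.
  apply (is_derive_filterdiff (fun u v => RInt (fun w => RInt (fun s => g s w) 0 u) 0 v)
    x y (fun u v => RInt (fun w => g u w) 0 v)).
  - apply filter_forall. intros [u v]. apply Hx.
  - apply (is_derive_RInt_0 (fun w => RInt (fun s => g s w) 0 x)).
    intros w. exact (continuous_2d_section_r _ x w (HI x w)).
  - apply (continuity_2d_pt_filterlim (fun u v => RInt (fun w => g u w) 0 v)).
    apply (continuity_2d_swap (fun v u => RInt (fun w => g u w) 0 v)).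
    apply (continuity_2d_RInt (fun w u => g u w)).
    intros w u. apply continuity_2d_swap, Hg.
Qed.

Lemma differentiable_pt_lim_add (k : R -> R) (F : R -> R -> R) (x y l a c : R) :
  is_derive k x l -> differentiable_pt_lim F x y a c ->
  differentiable_pt_lim (fun u v => k u + F u v) x y (l + a) c.
Proof.
  intros Hk%is_derive_Reals HF.
  assert (Hplus : differentiable_pt_lim Rplus (k x) (F x y) 1 1).
  { intros eps. exists eps. intros u v _ _.
    replace (u + v - (k x + F x y) - (1 * (u - k x) + 1 * (v - F x y))) with 0 by ring.
    rewrite Rabs_R0. apply Rmult_le_pos; [apply Rlt_le, eps|].
    eapply Rle_trans; [apply Rabs_pos|apply Rmax_l]. }
  replace (l + a) with (1 * l + 1 * a) by ring.
  replace c with (1 * 0 + 1 * c) by ring.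
  exact (differentiable_pt_lim_comp Rplus (fun u _ => k u) F x y _ _ _ _ _ _ Hplus
    (differentiable_pt_lim_proj1_0 k x y l Hk) HF).
Qed.

(** * Complex-valued functions of one real variable *)

(** In this form and the next, the equation between derivatives is typed in [R] or
    [C] rather than in a normed module, so that [ring] and [field] apply to it. *)
Lemma is_derive_R_eq (g : R -> R) (x l m : R) :
  is_derive g x l -> l = m -> is_derive g x m.
Proof. now intros H <-. Qed.

Lemma is_derive_C_eq (g : R -> C) (x : R) (l m : C) :
  is_derive (V := C_R_NormedModule) g x l -> l = m ->
  is_derive (V := C_R_NormedModule) g x m.
Proof. now intros H <-. Qed.

Lemma is_derive_pair {U V : NormedModule R_AbsRing} (g : R -> U) (k : R -> V)
    (x : R) (l : U) (m : V) :
  is_derive g x l -> is_derive k x m ->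
  is_derive (V := prod_NormedModule R_AbsRing U V) (fun y => (g y, k y)) x (l, m).
Proof.
  intros [_ Hg] [_ Hk]. split; [exact (is_linear_scal_l (V := _) _)|].
  intros y Hy eps.
  assert (Hs : 0 < eps / sqrt 2) by (apply Rdiv_lt_0_compat; [apply eps|apply Rlt_sqrt2_0]).
  generalize (filter_and _ _ (Hg y Hy (mkposreal _ Hs)) (Hk y Hy (mkposreal _ Hs))).
  apply filter_imp. intros z [H1 H2]. simpl in H1, H2.
  eapply Rle_trans.
  { apply (sqrt_plus_sqr (norm (minus (minus (g z) (g y)) (scal (minus z y) l)))
       (norm (minus (minus (k z) (k y)) (scal (minus z y) m)))). }
  assert (Hs2 := Rlt_sqrt2_0).
  apply Rle_trans with (sqrt 2 * (eps / sqrt 2 * norm (minus z y))).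
  - apply Rmult_le_compat_l; [apply sqrt_pos|].
    rewrite !(Rabs_pos_eq (norm _)) by apply norm_ge_0.
    now apply Rmax_lub.
  - apply Req_le. change (sqrt 2 * (eps / sqrt 2 * norm (minus z y)) = eps * norm (minus z y)).
    field. lra.
Qed.

Lemma is_derive_C_components (g : R -> C) (x : R) (l : C) :
  is_derive (V := C_R_NormedModule) g x l <->
  is_derive (fun s => fst (g s)) x (fst l) /\ is_derive (fun s => snd (g s)) x (snd l).
Proof.
  split.
  - intros H. split.
    + apply (filterdiff_comp' g (fst : C_R_NormedModule -> R_NormedModule) x _ fst H).
      apply filterdiff_linear, is_linear_fst.
    + apply (filterdiff_comp' g (snd : C_R_NormedModule -> R_NormedModule) x _ snd H).
      apply filterdiff_linear, is_linear_snd.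
  - intros [H1 H2].
    apply (is_derive_ext (V := C_R_NormedModule) (fun s => (fst (g s), snd (g s)))).
    { intros t. symmetry. apply surjective_pairing. }
    rewrite (surjective_pairing l).
    exact (is_derive_pair (U := R_NormedModule) (V := R_NormedModule) _ _ _ _ _ H1 H2).
Qed.

Lemma is_derive_C_plus (g k : R -> C) (x : R) (l m : C) :
  is_derive (V := C_R_NormedModule) g x l -> is_derive (V := C_R_NormedModule) k x m ->
  is_derive (V := C_R_NormedModule) (fun s => (g s + k s)%C) x (l + m)%C.
Proof. exact (is_derive_plus (V := C_R_NormedModule) g k x l m). Qed.

Lemma is_derive_C_minus (g k : R -> C) (x : R) (l m : C) :
  is_derive (V := C_R_NormedModule) g x l -> is_derive (V := C_R_NormedModule) k x m ->
  is_derive (V := C_R_NormedModule) (fun s => (g s - k s)%C) x (l - m)%C.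
Proof. exact (is_derive_minus (V := C_R_NormedModule) g k x l m). Qed.

Lemma is_derive_C_opp (g : R -> C) (x : R) (l : C) :
  is_derive (V := C_R_NormedModule) g x l ->
  is_derive (V := C_R_NormedModule) (fun s => (- g s)%C) x (- l)%C.
Proof. exact (is_derive_opp (V := C_R_NormedModule) g x l). Qed.

Lemma is_derive_C_mult (g k : R -> C) (x : R) (l m : C) :
  is_derive (V := C_R_NormedModule) g x l -> is_derive (V := C_R_NormedModule) k x m ->
  is_derive (V := C_R_NormedModule) (fun s => (g s * k s)%C) x (l * k x + g x * m)%C.
Proof.
  rewrite !is_derive_C_components. intros [g1 g2] [k1 k2]. simpl.
  assert (mult_d : forall (a c : R -> R) (da dc : R), is_derive a x da -> is_derive c x dc ->
     is_derive (fun s => a s * c s) x (da * c x + a x * dc)).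
  { intros a c da dc Ha Hc. apply (is_derive_mult a c x da dc Ha Hc Rmult_comm). }
  split.
  - eapply is_derive_R_eq.
    { exact (is_derive_minus (V := R_NormedModule) _ _ _ _ _
        (mult_d _ _ _ _ g1 k1) (mult_d _ _ _ _ g2 k2)). }
    unfold minus, plus, opp; simpl. ring.
  - eapply is_derive_R_eq.
    { exact (is_derive_plus (V := R_NormedModule) _ _ _ _ _
        (mult_d _ _ _ _ g1 k2) (mult_d _ _ _ _ g2 k1)). }
    unfold plus; simpl. ring.
Qed.

Lemma is_derive_C_shift (g : R -> C) (u v : R) (l : C) :
  is_derive (V := C_R_NormedModule) g (u + v) l ->
  is_derive (V := C_R_NormedModule) (fun w => g (u + w)) v l /\
  is_derive (V := C_R_NormedModule) (fun s => g (s + v)) u l.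
Proof.
  intros H.
  assert (Hadd : is_derive (fun w => u + w) v 1 /\ is_derive (fun s => s + v) u 1).
  { split; auto_derive; auto; ring. }
  destruct Hadd as [Hr Hl]. split; (eapply is_derive_C_eq;
    [|exact (scal_one (l : C_R_NormedModule))]).
  - exact (is_derive_comp (V := C_R_NormedModule) g (fun w => u + w) v l _ H Hr).
  - exact (is_derive_comp (V := C_R_NormedModule) g (fun s => s + v) u l _ H Hl).
Qed.

Lemma continuous_pair {T U V : UniformSpace} (g : T -> U) (k : T -> V) (x : T) :
  continuous g x -> continuous k x ->
  continuous (U := prod_UniformSpace U V) (fun y => (g y, k y)) x.
Proof.
  intros Hg Hk. apply (continuous_comp_2 g k (fun u v => (u, v)) x Hg Hk).
  apply (continuous_ext (fun z : prod_UniformSpace U V => z)); [now intros []|].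
  apply continuous_id.
Qed.

Lemma continuous_C_components {T : UniformSpace} (g : T -> C) (x : T) :
  continuous (U := C_R_NormedModule) g x <->
  continuous (fun y => fst (g y)) x /\ continuous (fun y => snd (g y)) x.
Proof.
  split.
  - intros H. split.
    + apply (continuous_comp (V := C_UniformSpace) g fst x H).
      destruct (g x). apply (continuous_fst (U := R_UniformSpace) (V := R_UniformSpace)).
    + apply (continuous_comp (V := C_UniformSpace) g snd x H).
      destruct (g x). apply (continuous_snd (U := R_UniformSpace) (V := R_UniformSpace)).
  - intros [H1 H2].
    apply (continuous_ext (fun y => (fst (g y), snd (g y)))).
    { intros y. symmetry. apply surjective_pairing. }
    exact (continuous_pair _ _ _ H1 H2).
Qed.

Lemma continuous_C_mult {T : UniformSpace} (g k : T -> C) (x : T) :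
  continuous (U := C_R_NormedModule) g x -> continuous (U := C_R_NormedModule) k x ->
  continuous (U := C_R_NormedModule) (fun y => (g y * k y)%C) x.
Proof.
  rewrite !continuous_C_components. intros [g1 g2] [k1 k2]. split.
  - apply (continuous_minus (V := R_NormedModule)); now apply (continuous_mult (K := R_AbsRing)).
  - apply (continuous_plus (V := R_NormedModule)); now apply (continuous_mult (K := R_AbsRing)).
Qed.

Lemma continuous_C_inv {T : UniformSpace} (g : T -> C) (x : T) :
  continuous (U := C_R_NormedModule) g x -> g x <> RtoC 0 ->
  continuous (U := C_R_NormedModule) (fun y => (/ g y)%C) x.
Proof.
  rewrite !continuous_C_components. intros [g1 g2] H0.
  assert (Hn : fst (g x) ^ 2 + snd (g x) ^ 2 <> 0).
  { intros H. apply H0. apply injective_projections; simpl; nra. }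
  assert (Hi : continuous (fun y => / (fst (g y) ^ 2 + snd (g y) ^ 2)) x).
  { apply (continuous_comp (fun y => fst (g y) ^ 2 + snd (g y) ^ 2) Rinv).
    - apply (continuous_plus (V := R_NormedModule));
        apply (continuous_mult (K := R_AbsRing)); try assumption;
        apply (continuous_mult (K := R_AbsRing)); try assumption; apply continuous_const.
    - now apply continuous_Rinv. }
  split.
  - now apply (continuous_mult (K := R_AbsRing)).
  - apply (continuous_mult (K := R_AbsRing)); [|exact Hi].
    now apply (continuous_opp (V := R_NormedModule)).
Qed.

(** The componentwise integral: unlike the abstract one it brings the results on
    real double integrals to bear directly. *)
Definition CInt (g : R -> C) (x0 x1 : R) : C :=
  (RInt (fun x => fst (g x)) x0 x1, RInt (fun x => snd (g x)) x0 x1).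

Lemma is_derive_CInt (g : R -> C) (x : R) :
  (forall x, continuous (U := C_R_NormedModule) g x) ->
  is_derive (V := C_R_NormedModule) (fun u => CInt g 0 u) x (g x).
Proof.
  intros H. apply is_derive_C_components. split.
  - apply (is_derive_RInt_0 (fun x => fst (g x))). intros y. now apply continuous_C_components.
  - apply (is_derive_RInt_0 (fun x => snd (g x))). intros y. now apply continuous_C_components.
Qed.

Lemma CInt_point (g : R -> C) (x : R) : CInt g x x = RtoC 0.
Proof. unfold CInt. now rewrite !(RInt_point (V := R_CompleteNormedModule)). Qed.

Lemma RInt_CInt (g : R -> C) (x0 x1 : R) :
  (forall x, continuous (U := C_R_NormedModule) g x) ->
  RInt (V := C_R_CompleteNormedModule) g x0 x1 = CInt g x0 x1.
Proof.
  intros H. apply (is_RInt_unique (V := C_R_CompleteNormedModule)).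
  apply (is_RInt_fct_extend_pair (U := R_NormedModule) (V := R_NormedModule));
    apply is_RInt_cont; intros x; now apply continuous_C_components.
Qed.

(** * Complex-valued functions of two real variables *)

Definition continuous_2d (G : R -> R -> C) : Prop :=
  forall p : R * R, continuous (U := C_R_NormedModule) (fun p => G (fst p) (snd p)) p.

Definition differentiable_2d (G : R -> R -> C) (x y : R) (a c : C) : Prop :=
  differentiable_pt_lim (fun u v => fst (G u v)) x y (fst a) (fst c) /\
  differentiable_pt_lim (fun u v => snd (G u v)) x y (snd a) (snd c).

Lemma continuous_2d_components (G : R -> R -> C) (x y : R) :
  continuous_2d G ->
  continuity_2d_pt (fun u v => fst (G u v)) x y /\
  continuity_2d_pt (fun u v => snd (G u v)) x y.
Proof.
  intros H. rewrite !continuity_2d_pt_filterlim.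
  exact (proj1 (continuous_C_components _ _) (H (x, y))).
Qed.

Lemma continuous_2d_of_components (G : R -> R -> C) :
  (forall x y, continuity_2d_pt (fun u v => fst (G u v)) x y) ->
  (forall x y, continuity_2d_pt (fun u v => snd (G u v)) x y) -> continuous_2d G.
Proof.
  intros H1 H2 [x y]. apply continuous_C_components. split.
  - now apply (continuity_2d_pt_filterlim (fun u v => fst (G u v)) x y).
  - now apply (continuity_2d_pt_filterlim (fun u v => snd (G u v)) x y).
Qed.

Lemma continuous_2d_comp {T : UniformSpace} (G : R -> R -> C) (phi psi : T -> R) (x : T) :
  continuous_2d G -> continuous phi x -> continuous psi x ->
  continuous (U := C_R_NormedModule) (fun y => G (phi y) (psi y)) x.
Proof.
  intros H Hphi Hpsi. exact (continuous_comp_2 phi psi G x Hphi Hpsi (H _)).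
Qed.

Lemma continuous_2d_swap (g : R -> R -> C) :
  continuous_2d g -> continuous_2d (fun u v => g v u).
Proof.
  intros Hg [x y]. apply (continuous_2d_comp g snd fst); [exact Hg|..].
  - apply continuous_snd.
  - apply continuous_fst.
Qed.

Lemma continuous_2d_sum (g : R -> C) :
  (forall x, continuous (U := C_R_NormedModule) g x) -> continuous_2d (fun u v => g (u + v)).
Proof.
  intros Hg [x y].
  apply (continuous_comp (fun p : R * R => fst p + snd p) g (x, y)); [|apply Hg].
  apply (continuous_plus (V := R_NormedModule)); [apply continuous_fst|apply continuous_snd].
Qed.

Lemma continuous_rotation (p : R * R) :
  continuous (fun p => (fst p + snd p) / 2) p /\ continuous (fun p => (fst p - snd p) / 2) p.
Proof.
  destruct p as [x y].
  assert (H1 := continuous_fst (U := R_UniformSpace) (V := R_UniformSpace) x y).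
  assert (H2 := continuous_snd (U := R_UniformSpace) (V := R_UniformSpace) x y).
  split; apply (continuous_mult (K := R_AbsRing)); try apply continuous_const.
  - now apply (continuous_plus (V := R_NormedModule)).
  - now apply (continuous_minus (V := R_NormedModule)).
Qed.

Lemma continuous_2d_kernel (G : R -> R -> C) : continuous_2d G -> continuous_2d (kernel G).
Proof.
  intros HG p. destruct (continuous_rotation p) as [H1 H2].
  now apply (continuous_2d_comp G (fun p => (fst p + snd p) / 2) (fun p => (fst p - snd p) / 2)).
Qed.

Lemma differentiable_2d_comp (G : R -> R -> C) (phi psi : R -> R) (t l m : R) (a c : C) :
  differentiable_2d G (phi t) (psi t) a c -> is_derive phi t l -> is_derive psi t m ->
  is_derive (V := C_R_NormedModule) (fun s => G (phi s) (psi s)) t (a * l + c * m)%C.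
Proof.
  intros [H1 H2] Hphi%is_derive_Reals Hpsi%is_derive_Reals.
  apply is_derive_C_components.
  split; (eapply is_derive_R_eq; [apply is_derive_Reals|]).
  - apply (derivable_pt_lim_comp_2d _ _ _ _ _ _ _ _ H1 Hphi Hpsi).
  - simpl. ring.
  - apply (derivable_pt_lim_comp_2d _ _ _ _ _ _ _ _ H2 Hphi Hpsi).
  - simpl. ring.
Qed.

Lemma differentiable_2d_partial_l (G : R -> R -> C) (x y : R) (a c : C) :
  differentiable_2d G x y a c -> is_derive (V := C_R_NormedModule) (fun s => G s y) x a.
Proof.
  intros H. eapply is_derive_C_eq.
  - apply (differentiable_2d_comp G (fun s => s) (fun _ => y) x 1 0 a c H);
      [exact (is_derive_id x)|exact (is_derive_const (V := R_NormedModule) y x)].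
  - ring.
Qed.

Lemma differentiable_2d_partial_r (G : R -> R -> C) (x y : R) (a c : C) :
  differentiable_2d G x y a c -> is_derive (V := C_R_NormedModule) (fun w => G x w) y c.
Proof.
  intros H. eapply is_derive_C_eq.
  - apply (differentiable_2d_comp G (fun _ => x) (fun w => w) y 0 1 a c H);
      [exact (is_derive_const (V := R_NormedModule) x y)|exact (is_derive_id y)].
  - ring.
Qed.

Lemma is_derive_kernel (G Gu Gv : R -> R -> C) (x t : R) :
  (forall u v, differentiable_2d G u v (Gu u v) (Gv u v)) ->
  is_derive (V := C_R_NormedModule) (fun s => kernel G s t) x
    ((kernel Gu x t + kernel Gv x t) / 2)%C /\
  is_derive (V := C_R_NormedModule) (fun s => kernel G x s) t
    ((kernel Gu x t - kernel Gv x t) / 2)%C.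
Proof.
  intros HG. assert (Hd := HG ((x + t) / 2) ((x - t) / 2)).
  split; eapply is_derive_C_eq.
  - apply (differentiable_2d_comp G (fun s => (s + t) / 2) (fun s => (s - t) / 2) x (/ 2) (/ 2)
      _ _ Hd); auto_derive; auto; field.
  - unfold kernel. rewrite RtoC_inv by lra. field.
  - apply (differentiable_2d_comp G (fun s => (x + s) / 2) (fun s => (x - s) / 2) t (/ 2) (- / 2)
      _ _ Hd); auto_derive; auto; field.
  - unfold kernel. rewrite RtoC_opp, RtoC_inv by lra. field.
Qed.

Lemma differentiable_continuous_2d (G Gu Gv : R -> R -> C) :
  (forall u v, differentiable_2d G u v (Gu u v) (Gv u v)) -> continuous_2d G.
Proof.
  intros H. apply continuous_2d_of_components; intros u v;
    apply differentiable_continuity_pt; do 2 eexists; apply H.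
Qed.

(** Boundedness on a square from uniform continuity: walk from the origin to
    [(x, y)] in [n] equal steps, on each of which the function moves by less
    than 1, with [n] independent of [(x, y)]. *)
Lemma continuous_2d_bounded (G : R -> R -> C) (m : R) :
  continuous_2d G -> exists B, 0 <= B /\
  forall x y, Rabs x <= m -> Rabs y <= m -> Cmod (G x y) <= B.
Proof.
  intros HG.
  assert (Hreal : forall g : R -> R -> R, (forall x y, continuity_2d_pt g x y) ->
    exists B, forall x y, Rabs x <= m -> Rabs y <= m -> Rabs (g x y) <= B).
  { intros g Hg.
    destruct (uniform_continuity_2d g (- m) m (- m) m (fun x y _ _ => Hg x y)
      (mkposreal _ Rlt_0_1)) as [d Hd]. simpl in Hd.
    destruct (INR_unbounded (Rmax 0 (m / d))) as [n Hn].
    assert (Hn0 : 0 < INR n) by (assert (H := Rmax_l 0 (m / d)); lra).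
    assert (Hstep : m / INR n < d).
    { assert (H := Rmax_r 0 (m / d)). assert (Hd0 := cond_pos d).
      apply Rlt_div_l; [exact Hn0|]. rewrite Rmult_comm. apply Rlt_div_l; [exact Hd0|]. lra. }
    exists (Rabs (g 0 0) + INR n). intros x y Hx Hy.
    assert (Hk : forall k, (k <= n)%nat ->
      Rabs (g (INR k * (x / INR n)) (INR k * (y / INR n))) <= Rabs (g 0 0) + INR k).
    { assert (Hin : forall k z, (k <= n)%nat -> Rabs z <= m -> - m <= INR k * (z / INR n) <= m).
      { intros k z Hkn Hz. apply Rabs_le_between.
        unfold Rdiv. rewrite !Rabs_mult, Rabs_inv.
        rewrite !(Rabs_pos_eq (INR _)) by apply pos_INR.
        apply le_INR in Hkn. assert (H0 := pos_INR k). assert (H1 := Rabs_pos z).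
        apply Rle_trans with (INR n * (Rabs z * / INR n)).
        - apply Rmult_le_compat_r; [|exact Hkn]. apply Rmult_le_pos; [exact H1|].
          now apply Rlt_le, Rinv_0_lt_compat.
        - apply Rle_trans with (2 := Hz). apply Req_le. field. lra. }
      assert (Hdist : forall k z, Rabs z <= m ->
        Rabs (INR (S k) * (z / INR n) - INR k * (z / INR n)) < d).
      { intros k z Hz. rewrite S_INR. replace (_ - _) with (z / INR n) by ring.
        unfold Rdiv. rewrite Rabs_mult, Rabs_inv, (Rabs_pos_eq (INR n)) by lra.
        apply Rle_lt_trans with (2 := Hstep).
        apply Rmult_le_compat_r; [|exact Hz]. now apply Rlt_le, Rinv_0_lt_compat. }
      induction k as [|k IH]; intros Hkn.
      - simpl INR. rewrite !Rmult_0_l. lra.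
      - specialize (IH (le_S_n _ _ (le_S _ _ Hkn))).
        assert (Hkn' : (k <= n)%nat) by (apply Nat.lt_le_incl, Hkn).
        specialize (Hd _ _ _ _ (Hin k x Hkn' Hx) (Hin k y Hkn' Hy)
          (Hin (S k) x Hkn Hx) (Hin (S k) y Hkn Hy) (Hdist k x Hx) (Hdist k y Hy)).
        assert (Ht := Rabs_triang_inv (g (INR (S k) * (x / INR n)) (INR (S k) * (y / INR n)))
          (g (INR k * (x / INR n)) (INR k * (y / INR n)))).
        rewrite (S_INR k) at 3. lra. }
    specialize (Hk n (le_n n)).
    replace (INR n * (x / INR n)) with x in Hk by (field; lra).
    replace (INR n * (y / INR n)) with y in Hk by (field; lra). exact Hk. }
  destruct (Hreal (fun u v => fst (G u v))) as [B1 H1].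
  { intros x y. now apply continuous_2d_components. }
  destruct (Hreal (fun u v => snd (G u v))) as [B2 H2].
  { intros x y. now apply continuous_2d_components. }
  exists (Rabs B1 + Rabs B2). split.
  { assert (K1 := Rabs_pos B1). assert (K2 := Rabs_pos B2). lra. }
  intros x y Hx Hy.
  replace (G x y) with (RtoC (fst (G x y)) + Ci * RtoC (snd (G x y)))%C
    by (apply injective_projections; simpl; ring).
  eapply Rle_trans; [apply Cmod_triangle|]. rewrite Cmod_mult, Cmod_Ci, !Cmod_R.
  specialize (H1 x y Hx Hy). specialize (H2 x y Hx Hy).
  assert (K1 := Rle_abs B1). assert (K2 := Rle_abs B2). lra.
Qed.

Lemma continuous_2d_CInt_l (g : R -> R -> C) :
  continuous_2d g -> continuous_2d (fun u v => CInt (fun s => g s v) 0 u).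
Proof.
  intros Hg. apply continuous_2d_of_components; intros x y.
  - apply (continuity_2d_RInt (fun s w => fst (g s w))).
    intros u v. now apply continuous_2d_components.
  - apply (continuity_2d_RInt (fun s w => snd (g s w))).
    intros u v. now apply continuous_2d_components.
Qed.

Lemma differentiable_2d_double_CInt (k : R -> C) (g : R -> R -> C) (u v : R) (l : C) :
  continuous_2d g -> is_derive (V := C_R_NormedModule) k u l ->
  differentiable_2d (fun u v => (k u + CInt (fun w => CInt (fun s => g s w) 0 u) 0 v)%C) u v
    (l + CInt (fun w => g u w) 0 v)%C (CInt (fun s => g s v) 0 u).
Proof.
  intros Hg [k1 k2]%is_derive_C_components. split.
  - apply (differentiable_pt_lim_add (fun u => fst (k u))); [exact k1|].
    apply (differentiable_double_RInt (fun s w => fst (g s w))).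
    intros x y. now apply continuous_2d_components.
  - apply (differentiable_pt_lim_add (fun u => snd (k u))); [exact k2|].
    apply (differentiable_double_RInt (fun s w => snd (g s w))).
    intros x y. now apply continuous_2d_components.
Qed.

(** * The homogeneous characteristic problem on the diamond *)

Lemma Re_conj_le (z w : C) : fst z * fst w + snd z * snd w <= Cmod z * Cmod w.
Proof.
  rewrite <- (Cmod_conj w), <- Cmod_mult.
  eapply Rle_trans; [|apply re_le_Cmod]. eapply Rle_trans; [|apply Rle_abs].
  simpl. apply Req_le. ring.
Qed.

Lemma Cmod_sqr (z : C) : Cmod z * Cmod z = fst z * fst z + snd z * snd z.
Proof.
  unfold Cmod. rewrite sqrt_sqrt; [ring|]. nra.
Qed.

(** With z = phi(v), compare the real function w |-> Re (conj z * phi(w)) with the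
    antiderivative of |z| K (a + w)^n; at w = v the former equals |z|^2, and one
    divides by |z|. *)
Lemma Cmod_growth_pos (phi dphi : R -> C) (a K v : R) (n : nat) :
  0 <= a -> 0 <= K -> 0 <= v -> phi 0 = RtoC 0 ->
  (forall w, Rabs w <= v -> is_derive (V := C_R_NormedModule) phi w (dphi w)) ->
  (forall w, Rabs w <= v -> Cmod (dphi w) <= K * (a + Rabs w) ^ n) ->
  Cmod (phi v) <= K * (a + v) ^ S n / INR (S n).
Proof.
  intros Ha HK Hv H0 Hd Hb. set (z := phi v).
  assert (HS : 0 < INR (S n)) by apply lt_0_INR, Nat.lt_0_succ.
  set (chi := fun w => Cmod z * (K / INR (S n)) * (a + w) ^ S n -
     (fst z * fst (phi w) + snd z * snd (phi w))).
  set (dchi := fun w => Cmod z * K * (a + w) ^ n -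
     (fst z * fst (dphi w) + snd z * snd (dphi w))).
  assert (Hchi : forall w, 0 <= w <= v -> is_derive chi w (dchi w)).
  { intros w Hw.
    destruct (proj1 (is_derive_C_components _ _ _) (Hd w ltac:(rewrite Rabs_pos_eq; lra)))
      as [H1 H2].
    assert (Hreal : forall (c z1 z2 d1 d2 : R) (p1 p2 : R -> R),
      is_derive p1 w d1 -> is_derive p2 w d2 ->
      is_derive (fun w => c * (K / INR (S n)) * (a + w) ^ S n - (z1 * p1 w + z2 * p2 w)) w
        (c * K * (a + w) ^ n - (z1 * d1 + z2 * d2))).
    { intros c z1 z2 d1 d2 p1 p2 P1 P2.
      assert (E1 := is_derive_unique _ _ _ P1). assert (E2 := is_derive_unique _ _ _ P2).
      auto_derive.
      - repeat split; eexists; eassumption.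
      - cbv beta in E1, E2. change (fun x => p1 x) with p1. change (fun x => p2 x) with p2.
        rewrite E1, E2.
        change (match n with 0%nat => 1 | S _ => INR n + 1 end) with (INR (S n)) in *.
        simpl pred. field. lra. }
    exact (Hreal _ _ _ _ _ _ _ H1 H2). }
  destruct (MVT_gen chi 0 v dchi) as (c & Hc & Hmvt);
    rewrite ?Rmin_left, ?Rmax_right in * by lra.
  - intros w Hw. apply Hchi. lra.
  - intros w Hw. apply continuity_pt_filterlim.
    apply (ex_derive_continuous (V := R_NormedModule)). eexists. now apply Hchi.
  - assert (Hz := Cmod_ge_0 z).
    assert (Hpos : 0 <= dchi c).
    { unfold dchi. specialize (Hb c ltac:(rewrite Rabs_pos_eq; lra)).
      rewrite (Rabs_pos_eq c) in Hb by lra.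
      assert (Hcs := Re_conj_le z (dphi c)).
      assert (Hm := Rmult_le_compat_l _ _ _ Hz Hb). lra. }
    assert (Hge : chi 0 <= chi v).
    { assert (0 <= dchi c * (v - 0)) by (apply Rmult_le_pos; lra). lra. }
    assert (Hc0 : 0 <= chi 0).
    { unfold chi. rewrite H0. simpl fst; simpl snd.
      assert (0 <= Cmod z * (K / INR (S n)) * (a + 0) ^ S n); [|lra].
      repeat apply Rmult_le_pos; try lra.
      - apply Rlt_le, Rinv_0_lt_compat, HS.
      - apply pow_le. lra. }
    unfold chi in Hge at 2. fold z in Hge. rewrite <- Cmod_sqr in Hge.
    destruct Hz as [Hz| <-].
    + apply (Rmult_le_reg_l (Cmod z)); [exact Hz|]. unfold Rdiv in *. lra.
    + apply Rdiv_le_0_compat; [|exact HS]. apply Rmult_le_pos; [exact HK|].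
      apply pow_le. lra.
Qed.

Lemma Cmod_growth (phi dphi : R -> C) (a K v : R) (n : nat) :
  0 <= a -> 0 <= K -> phi 0 = RtoC 0 ->
  (forall w, Rabs w <= Rabs v -> is_derive (V := C_R_NormedModule) phi w (dphi w)) ->
  (forall w, Rabs w <= Rabs v -> Cmod (dphi w) <= K * (a + Rabs w) ^ n) ->
  Cmod (phi v) <= K * (a + Rabs v) ^ S n / INR (S n).
Proof.
  intros Ha HK H0 Hd Hb. destruct (Rle_dec 0 v) as [Hv|Hv].
  - rewrite Rabs_pos_eq in * by exact Hv. now apply (Cmod_growth_pos phi dphi).
  - rewrite Rabs_left in * by lra.
    (* reflect in the origin *)
    replace v with (- - v) at 1 by ring.
    apply (Cmod_growth_pos (fun w => phi (- w)) (fun w => (- dphi (- w)%R)%C)); try lra.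
    + now rewrite Ropp_0.
    + intros w Hw. rewrite <- Rabs_Ropp in Hw.
      eapply is_derive_C_eq.
      * apply (is_derive_comp (V := C_R_NormedModule) phi Ropp w).
        -- apply Hd, Hw.
        -- exact (is_derive_opp (V := R_NormedModule) (fun x => x) w _ (is_derive_id w)).
      * apply injective_projections.
        -- change (- (1) * fst (dphi (- w)) = - fst (dphi (- w))). ring.
        -- change (- (1) * snd (dphi (- w)) = - snd (dphi (- w))). ring.
    + intros w Hw. rewrite Cmod_opp, <- (Rabs_Ropp w). apply Hb. now rewrite Rabs_Ropp.
Qed.

(** The image of the square under u = (x + t)/2, v = (x - t)/2.  With a point it
    contains the rectangle spanned by that point and the origin, which makes
    integration along characteristics from the axes possible. *)
Definition diamond (b u v : R) : Prop := Rabs u + Rabs v <= b.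

Lemma diamond_le (b u v s w : R) :
  diamond b u v -> Rabs s <= Rabs u -> Rabs w <= Rabs v -> diamond b s w.
Proof. unfold diamond. lra. Qed.

Lemma between_Rabs (x y : R) : Rmin 0 y <= x <= Rmax 0 y -> Rabs x <= Rabs y.
Proof. unfold Rmin, Rmax, Rabs. destruct Rle_dec; repeat destruct Rcase_abs; lra. Qed.

Lemma diamond_hexagon (b u v : R) : diamond b u v -> hexagon b u v.
Proof.
  unfold diamond, hexagon. intros H.
  assert (Hu := Rabs_pos u). assert (Hv := Rabs_pos v). assert (Ht := Rabs_triang u v). lra.
Qed.

Lemma diamond_square (b u v : R) : diamond b u v -> square b (u + v) (u - v).
Proof.
  unfold diamond, square. intros H. unfold Rminus.
  assert (H1 := Rabs_triang u v). assert (H2 := Rabs_triang u (- v)).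
  rewrite Rabs_Ropp in H2. lra.
Qed.

Lemma square_diamond (b x t : R) : square b x t -> diamond b ((x + t) / 2) ((x - t) / 2).
Proof.
  unfold square, diamond, Rabs. intros [Hx Ht]. repeat destruct Rcase_abs; lra.
Qed.

(** Integrating both equations from the axes improves the bound
    B (2 M r)^n / n!, r = |u| + |v|, to the one for n + 1; the bounds tend to 0. *)
Lemma Goursat_system_zero (b M B : R) (E F dE dF : R -> R -> C) :
  0 <= M -> 0 <= B ->
  (forall u v, diamond b u v ->
     is_derive (V := C_R_NormedModule) (fun w => E u w) v (dE u v) /\
     is_derive (V := C_R_NormedModule) (fun s => F s v) u (dF u v) /\
     Cmod (dE u v) <= M * (Cmod (E u v) + Cmod (F u v)) /\
     Cmod (dF u v) <= M * (Cmod (E u v) + Cmod (F u v)) /\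
     Cmod (E u v) <= B /\ Cmod (F u v) <= B) ->
  (forall u, diamond b u 0 -> E u 0 = RtoC 0) ->
  (forall v, diamond b 0 v -> F 0 v = RtoC 0) ->
  forall u v, diamond b u v -> E u v = RtoC 0 /\ F u v = RtoC 0.
Proof.
  intros HM HB H HE0 HF0.
  assert (Hfact : forall n, 0 < INR (fact n)) by (intros n; apply lt_0_INR, lt_O_fact).
  assert (K_ge0 : forall n, 0 <= B * (2 * M) ^ S n / INR (fact n)).
  { intros n. apply Rdiv_le_0_compat; [|apply Hfact]. apply Rmult_le_pos; [exact HB|].
    apply pow_le. lra. }
  assert (Hn : forall n u v, diamond b u v ->
     Cmod (E u v) <= B * ((2 * M * (Rabs u + Rabs v)) ^ n / INR (fact n)) /\
     Cmod (F u v) <= B * ((2 * M * (Rabs u + Rabs v)) ^ n / INR (fact n))).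
  { induction n as [|n IH]; intros u v Huv.
    { destruct (H u v Huv) as (_ & _ & _ & _ & HbE & HbF). simpl. lra. }
    assert (Hb : forall s w, diamond b s w ->
      M * (Cmod (E s w) + Cmod (F s w)) <=
      B * (2 * M) ^ S n / INR (fact n) * (Rabs s + Rabs w) ^ n).
    { intros s w Hsw. destruct (IH s w Hsw) as [H1 H2].
      replace (B * (2 * M) ^ S n / INR (fact n) * (Rabs s + Rabs w) ^ n) with
        (M * (B * ((2 * M * (Rabs s + Rabs w)) ^ n / INR (fact n)) +
              B * ((2 * M * (Rabs s + Rabs w)) ^ n / INR (fact n)))).
      - apply Rmult_le_compat_l; [exact HM|]. lra.
      - rewrite (Rpow_mult_distr (2 * M)). simpl pow. field. apply Rgt_not_eq, Hfact. }
    assert (Hend : forall r, B * (2 * M) ^ S n / INR (fact n) * r ^ S n / INR (S n) =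
       B * ((2 * M * r) ^ S n / INR (fact (S n)))).
    { intros r. rewrite (Rpow_mult_distr (2 * M) r), fact_simpl, mult_INR. field.
      split; [apply Rgt_not_eq, Hfact|now apply not_0_INR]. }
    rewrite <- Hend. unfold diamond in *. split.
    - apply (Cmod_growth (fun w => E u w) (fun w => dE u w)); [apply Rabs_pos|apply K_ge0|..].
      + apply HE0. rewrite Rabs_R0. assert (Hv := Rabs_pos v). lra.
      + intros w Hw. apply H. lra.
      + intros w Hw. eapply Rle_trans; [apply H; lra|]. apply Hb. lra.
    - rewrite (Rplus_comm (Rabs u)).
      apply (Cmod_growth (fun s => F s v) (fun s => dF s v)); [apply Rabs_pos|apply K_ge0|..].
      + apply HF0. rewrite Rabs_R0. assert (Hv := Rabs_pos u). lra.
      + intros s Hs. apply H. lra.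
      + intros s Hs. eapply Rle_trans; [apply H; lra|]. rewrite (Rplus_comm (Rabs v)).
        apply Hb. lra. }
  intros u v Huv.
  assert (Hlim : is_lim_seq (fun n => B * ((2 * M * (Rabs u + Rabs v)) ^ n / INR (fact n))) 0).
  { evar_last.
    - apply is_lim_seq_scal_l, is_lim_seq_Reals, cv_speed_pow_fact.
    - simpl. now rewrite Rmult_0_r. }
  assert (Hz : forall z, (forall n, Cmod z <= B * ((2 * M * (Rabs u + Rabs v)) ^ n / INR (fact n))) ->
     z = RtoC 0).
  { intros z Hz. apply Cmod_eq_0, Rle_antisym; [|apply Cmod_ge_0].
    exact (is_lim_seq_le _ _ (Cmod z) 0 Hz (is_lim_seq_const _) Hlim). }
  split; apply Hz; intros n; now apply Hn.
Qed.

(** A linear equation in the variable [v] alone is the special case F = 0 of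
    [Goursat_system_zero]. *)
Lemma linear_ode_zero (b M : R) (p y : R -> C) :
  0 <= M -> (forall x, segment b x -> Cmod (p x) <= M) ->
  (forall x, continuous (U := C_R_NormedModule) y x) ->
  (forall x, segment b x -> is_derive (V := C_R_NormedModule) y x (p x * y x)%C) ->
  y 0 = RtoC 0 -> forall x, segment b x -> y x = RtoC 0.
Proof.
  intros HM Hp Hc Hd H0 x Hx.
  destruct (continuous_2d_bounded (fun _ v => y v) b) as (B & HB & Hy).
  { intros q. apply (continuous_comp snd y); [destruct q; apply continuous_snd|apply Hc]. }
  assert (Hdia : forall u v, diamond b u v -> segment b v).
  { intros u v. unfold diamond, segment. assert (H := Rabs_pos u). lra. }
  apply (Goursat_system_zero b M B (fun _ v => y v) (fun _ _ => RtoC 0)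
    (fun _ v => (p v * y v)%C) (fun _ _ => RtoC 0) HM HB) with (u := 0) (v := x).
  - intros u v Huv%Hdia. rewrite Cmod_0, Cmod_mult, Rplus_0_r.
    assert (Hm := Hp v Huv). assert (Hyv := Cmod_ge_0 (y v)).
    refine (conj _ (conj _ (conj _ (conj _ (conj _ _))))).
    + now apply Hd.
    + apply (is_derive_const (V := C_R_NormedModule)).
    + now apply Rmult_le_compat_r.
    + now apply Rmult_le_pos.
    + apply Hy with (x := 0); [rewrite Rabs_R0; unfold segment in *|exact Huv].
      assert (H := Rabs_pos v). lra.
    + exact HB.
  - intros _ _. exact H0.
  - reflexivity.
  - unfold diamond. now rewrite Rabs_R0, Rplus_0_l.
Qed.

(** * Solutions of the Goursat problem are C^1 *)

Lemma continuous_on_clamp (b : R) (q : R -> C) (x : R) :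
  0 < b -> continuous_on (T := R_UniformSpace) (U := C_R_NormedModule) (segment b) q ->
  continuous (U := C_R_NormedModule) (fun x => q (clamp b x)) x.
Proof.
  intros Hb Hq. apply (continuous_on_comp (segment b) q (clamp b)).
  - exact Hq.
  - intros y. now apply clamp_segment.
  - apply clamp_continuous.
Qed.

(** [G] is a C^1 function on the plane, with partial derivatives [Gu] and [Gv],
    that agrees with the Goursat solution [H] on the diamond. Both orders of
    the mixed derivative are recorded, together with the values on the axes. *)
Record Goursat_extension (b : R) (q : R -> C) (h : C) (H G Gu Gv : R -> R -> C) : Prop := {
  ext_cont_u : continuous_2d Gu;
  ext_cont_v : continuous_2d Gv;
  ext_diff : forall u v, differentiable_2d G u v (Gu u v) (Gv u v);
  ext_eq : forall u v, diamond b u v -> H u v = G u v;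
  ext_uv : forall u v, diamond b u v ->
    is_derive (V := C_R_NormedModule) (fun w => Gu u w) v (q (u + v)%R * G u v)%C /\
    is_derive (V := C_R_NormedModule) (fun s => Gv s v) u (q (u + v)%R * G u v)%C;
  ext_0v : forall v, G 0 v = (h / 2)%C;
  ext_u_u0 : forall u, segment b u -> Gu u 0 = (q u / 2)%C;
  ext_v_0v : forall v, Gv 0 v = RtoC 0 }.

(** [G] is the integral representation of [H] with clamped integrands. That [H]
    equals [G] on the diamond is seen in two integrations: first of [Hv] along
    lines v = const, starting from Hv(0, v) = 0, then of [H] along lines
    u = const. *)
Lemma Goursat_extension_exists (b : R) (q : R -> C) (h : C) (H : R -> R -> C) :
  0 < b -> continuous_on (T := R_UniformSpace) (U := C_R_NormedModule) (segment b) q ->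
  goursat_solution b q h H -> exists G Gu Gv, Goursat_extension b q h H G Gu Gv.
Proof.
  intros Hb Hq (Hc & (Hv & Hder) & Hu0 & H0v).
  set (qc := fun x => q (clamp b x)).
  assert (qc_cont : forall x, continuous (U := C_R_NormedModule) qc x).
  { intros x. now apply continuous_on_clamp. }
  (* in the coordinates x = s + w, t = s - w the clamping retracts the plane onto
     the diamond *)
  set (g := fun s w => (qc (s + w)%R * kernel H (clamp b (s + w)) (clamp b (s - w)))%C).
  assert (g_diamond : forall u v, diamond b u v -> g u v = (q (u + v)%R * H u v)%C).
  { intros u v Huv. destruct (diamond_square _ _ _ Huv) as [H1 H2].
    unfold g, qc, kernel. rewrite !clamp_id by assumption.
    now replace ((u + v + (u - v)) / 2) with u by field;
      replace ((u + v - (u - v)) / 2) with v by field. }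
  assert (g_cont : continuous_2d g).
  { intros p.
    assert (Hp : continuous (fun p : R * R => fst p + snd p) p /\
      continuous (fun p : R * R => fst p - snd p) p).
    { destruct p as [x y].
      assert (H1 := continuous_fst (U := R_UniformSpace) (V := R_UniformSpace) x y).
      assert (H2 := continuous_snd (U := R_UniformSpace) (V := R_UniformSpace) x y).
      split; [now apply (continuous_plus (V := R_NormedModule))|
              now apply (continuous_minus (V := R_NormedModule))]. }
    destruct Hp as [Hp Hm]. apply continuous_C_mult.
    - exact (continuous_comp _ qc p Hp (qc_cont _)).
    - set (cp := fun p : R * R => clamp b (fst p + snd p)).
      set (cm := fun p : R * R => clamp b (fst p - snd p)).
      assert (Hcp : continuous cp p) by (apply (continuous_comp _ _ p Hp), clamp_continuous).
      assert (Hcm : continuous cm p) by (apply (continuous_comp _ _ p Hm), clamp_continuous).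
      apply (continuous_on_comp (fun p => hexagon b (fst p) (snd p))
        (fun p => H (fst p) (snd p)) (fun p => ((cp p + cm p) / 2, (cp p - cm p) / 2))).
      + exact Hc.
      + intros y. apply diamond_hexagon, square_diamond.
        split; now apply clamp_segment.
      + destruct (continuous_rotation (cp p, cm p)) as [R1 R2].
        apply (continuous_pair (fun p => (cp p + cm p) / 2) (fun p => (cp p - cm p) / 2)).
        * exact (continuous_comp_2 cp cm (fun x y => (x + y) / 2) p Hcp Hcm R1).
        * exact (continuous_comp_2 cp cm (fun x y => (x - y) / 2) p Hcp Hcm R2). }
  assert (g_l : forall v x, continuous (U := C_R_NormedModule) (fun s => g s v) x).
  { intros v x. apply (continuous_2d_comp g (fun s => s) (fun _ => v)); [exact g_cont|..].
    - apply continuous_id.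
    - apply continuous_const. }
  assert (g_r : forall u x, continuous (U := C_R_NormedModule) (fun w => g u w) x).
  { intros u x. apply (continuous_2d_comp g (fun _ => u) (fun w => w)); [exact g_cont|..].
    - apply continuous_const.
    - apply continuous_id. }
  set (k := fun u => (h / 2 + / 2 * CInt qc 0 u)%C).
  assert (k_der : forall u, is_derive (V := C_R_NormedModule) k u (qc u / 2)%C).
  { intros u. eapply is_derive_C_eq.
    - apply (is_derive_plus (V := C_R_NormedModule) (fun _ => (h / 2)%C)
        (fun u => (/ 2 * CInt qc 0 u)%C)).
      + apply (is_derive_const (V := C_R_NormedModule)).
      + apply (is_derive_C_mult (fun _ => (/ 2)%C) (fun u => CInt qc 0 u) u (RtoC 0) (qc u)).
        * exact (is_derive_const (V := C_R_NormedModule) (/ 2)%C u).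
        * now apply is_derive_CInt.
    - change (0 + (0 * CInt qc 0 u + / 2 * qc u) = qc u / 2)%C. unfold Cdiv. ring. }
  assert (G_diff := fun u v => differentiable_2d_double_CInt k g u v (qc u / 2)%C g_cont (k_der u)).
  set (G := fun u v => (k u + CInt (fun w => CInt (fun s => g s w) 0 u) 0 v)%C).
  set (Gu := fun u v => (qc u / 2 + CInt (fun w => g u w) 0 v)%C).
  set (Gv := fun u v => CInt (fun s => g s v) 0 u).
  assert (Hv_eq : forall u v, diamond b u v -> Hv u v = Gv u v).
  { intros u v Huv.
    assert (H0 : Hv 0 v = RtoC 0).
    { assert (Hseg : segment b v) by (destruct (diamond_hexagon _ _ _ Huv); tauto).
      apply (is_derive_on_const_unique (V := C_R_NormedModule) b (fun s => hexagon b 0 s)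
        (fun s => H 0 s) (h / 2)%C _ v Hb Hseg).
      - intros y Hy. split; [|now apply H0v].
        apply diamond_hexagon. unfold diamond. rewrite Rabs_R0, Rplus_0_l. exact Hy.
      - apply Hder, diamond_hexagon. unfold diamond. rewrite Rabs_R0, Rplus_0_l. exact Hseg. }
    apply (derive_on_eq (V := C_R_NormedModule) (fun s => hexagon b s v)
      (fun s => Hv s v) (fun s => Gv s v) (fun s => g s v) 0 u).
    - intros s Hs%between_Rabs.
      assert (Hsv : diamond b s v) by (apply (diamond_le b u v); [assumption..|lra]).
      split; [now apply diamond_hexagon|]. split.
      + rewrite g_diamond by exact Hsv. now apply Hder, diamond_hexagon.
      + apply (is_derive_CInt (fun s => g s v)). apply g_l.
    - unfold Gv. now rewrite CInt_point. }
  assert (Hu0_eq : forall u, segment b u -> H u 0 = G u 0).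
  { intros u Hu. rewrite Hu0 by exact Hu. unfold G, k. rewrite CInt_point, Cplus_0_r.
    rewrite <- RInt_CInt by exact qc_cont. do 2 f_equal.
    apply (RInt_ext (V := C_R_CompleteNormedModule)). intros x Hx.
    unfold qc. rewrite clamp_id; [reflexivity|].
    assert (Hx' := between_Rabs x u ltac:(lra)). unfold segment in *. lra. }
  assert (H_eq : forall u v, diamond b u v -> H u v = G u v).
  { intros u v Huv.
    apply (derive_on_eq (V := C_R_NormedModule) (fun w => hexagon b u w)
      (fun w => H u w) (fun w => G u w) (fun w => Gv u w) 0 v).
    - intros w Hw%between_Rabs.
      assert (Huw : diamond b u w) by (apply (diamond_le b u v); [assumption|lra|assumption]).
      split; [now apply diamond_hexagon|]. split.
      + rewrite <- Hv_eq by exact Huw. now apply Hder, diamond_hexagon.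
      + apply (differentiable_2d_partial_r G u w _ _ (G_diff u w)).
    - apply Hu0_eq. now destruct (diamond_hexagon _ _ _ Huv). }
  exists G, Gu, Gv. constructor.
  - intros p. apply (continuous_plus (V := C_R_NormedModule)).
    + apply (continuous_C_mult (fun p => qc (fst p)) (fun _ => (/ 2)%C)).
      * apply (continuous_comp fst qc); [|apply qc_cont].
        destruct p. apply continuous_fst.
      * apply continuous_const.
    + apply (continuous_2d_swap (fun v u => CInt (fun w => g u w) 0 v)).
      apply (continuous_2d_CInt_l (fun w u => g u w)). now apply continuous_2d_swap.
  - now apply continuous_2d_CInt_l.
  - exact G_diff.
  - exact H_eq.
  - intros u v Huv. rewrite <- H_eq, <- g_diamond by exact Huv. split.
    + eapply is_derive_C_eq.
      * apply (is_derive_plus (V := C_R_NormedModule) (fun _ => (qc u / 2)%C)).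
        -- apply (is_derive_const (V := C_R_NormedModule)).
        -- apply (is_derive_CInt (fun w => g u w)). apply g_r.
      * exact (Cplus_0_l _).
    + apply (is_derive_CInt (fun s => g s v)). apply g_l.
  - intros v. unfold G, k. rewrite CInt_point.
    assert (Hz : CInt (fun w => CInt (fun s => g s w) 0 0) 0 v = RtoC 0).
    { unfold CInt. apply injective_projections; simpl;
        (transitivity (RInt (fun _ => 0) 0 v);
          [apply RInt_ext; intros w _; apply (RInt_point (V := R_CompleteNormedModule))|
           rewrite RInt_const; apply Rmult_0_r]). }
    rewrite Hz. ring.
  - intros u Hu. unfold Gu. rewrite CInt_point, Cplus_0_r. unfold qc. now rewrite clamp_id.
  - intros v. apply CInt_point.
Qed.

(** * Extension of f and continuity of the potentials *)

(** Continue [dg] by constants beyond the end points and integrate; the integral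
    agrees with [g] on the segment because the derivatives do. *)
Lemma segment_extension (b : R) (g dg : R -> C) :
  0 < b -> continuous_on (T := R_UniformSpace) (U := C_R_NormedModule) (segment b) dg ->
  (forall x, segment b x -> is_derive_on (V := C_R_NormedModule) (segment b) g x (dg x)) ->
  exists G : R -> C,
    (forall x, is_derive (V := C_R_NormedModule) G x (dg (clamp b x))) /\
    (forall x, segment b x -> g x = G x).
Proof.
  intros Hb Hc Hd. set (dgc := fun x => dg (clamp b x)).
  assert (Hder : forall x, is_derive (V := C_R_NormedModule)
     (fun x => (g 0 + CInt dgc 0 x)%C) x (dgc x)).
  { intros x. eapply is_derive_C_eq.
    - apply (is_derive_plus (V := C_R_NormedModule) (fun _ => g 0)).
      + apply (is_derive_const (V := C_R_NormedModule)).
      + apply is_derive_CInt. intros y. now apply continuous_on_clamp.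
    - apply (plus_zero_l (dgc x : C_R_NormedModule)). }
  exists (fun x => (g 0 + CInt dgc 0 x)%C). split; [exact Hder|].
  intros x Hx. apply (derive_on_eq (V := C_R_NormedModule) (segment b) g
    (fun x => (g 0 + CInt dgc 0 x)%C) dgc 0 x).
  - intros y Hy%between_Rabs.
    assert (Hyb : segment b y) by (unfold segment in *; lra).
    split; [exact Hyb|]. split; [|apply Hder].
    unfold dgc. rewrite clamp_id by exact Hyb. now apply Hd.
  - rewrite CInt_point. symmetry. apply Cplus_0_r.
Qed.

(** [F0] and [F1] extend [f] and [f'] beyond the end points, so that at every
    point of the segment the derivatives are two-sided. *)
Lemma C2_on_extension (b : R) (f f' f'' : R -> C) :
  0 < b -> C2_on b f f' f'' -> exists F0 F1 : R -> C,
    (forall x, continuous (U := C_R_NormedModule) F0 x) /\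
    (forall x, continuous (U := C_R_NormedModule) F1 x) /\
    (forall x, segment b x ->
       f x = F0 x /\ f' x = F1 x /\
       is_derive (V := C_R_NormedModule) F0 x (f' x) /\
       is_derive (V := C_R_NormedModule) F1 x (f'' x)).
Proof.
  intros Hb [Hder Hf''].
  destruct (segment_extension b f' f'' Hb Hf'') as (F1 & F1_der & F1_eq);
    [intros x Hx; now apply Hder|].
  assert (F1_cont : forall x, continuous (U := C_R_NormedModule) F1 x).
  { intros x. apply (ex_derive_continuous (V := C_R_NormedModule)). eexists. apply F1_der. }
  destruct (segment_extension b f F1 Hb) as (F0 & F0_der & F0_eq).
  { apply continuous_on_forall. intros x _. apply F1_cont. }
  { intros x Hx. rewrite <- F1_eq by exact Hx. now apply Hder. }
  exists F0, F1. split; [|split; [exact F1_cont|]].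
  - intros x. apply (ex_derive_continuous (V := C_R_NormedModule)). eexists. apply F0_der.
  - intros x Hx. refine (conj (F0_eq x Hx) (conj (F1_eq x Hx) (conj _ _))).
    + rewrite F1_eq by exact Hx. assert (Hd := F0_der x). now rewrite clamp_id in Hd.
    + assert (Hd := F1_der x). now rewrite clamp_id in Hd.
Qed.

Lemma continuous_on_segment_of_clamp (b : R) (g : R -> C) :
  (forall x, continuous (U := C_R_NormedModule) (fun x => g (clamp b x)) x) ->
  continuous_on (T := R_UniformSpace) (U := C_R_NormedModule) (segment b) g.
Proof.
  intros H. apply (continuous_on_ext (segment b) (fun x => g (clamp b x))).
  - intros x Hx. now rewrite clamp_id.
  - apply continuous_on_forall. intros x _. apply H.
Qed.

Lemma continuous_on_segment_Cdiv (b : R) (g k : R -> C) :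
  0 < b -> (forall x, segment b x -> k x <> RtoC 0) ->
  continuous_on (T := R_UniformSpace) (U := C_R_NormedModule) (segment b) g ->
  continuous_on (T := R_UniformSpace) (U := C_R_NormedModule) (segment b) k ->
  continuous_on (T := R_UniformSpace) (U := C_R_NormedModule) (segment b)
    (fun x => (g x / k x)%C).
Proof.
  intros Hb Hk0 Hg Hk. apply continuous_on_segment_of_clamp. intros x.
  apply (continuous_C_mult (fun x => g (clamp b x)) (fun x => (/ k (clamp b x))%C)).
  - now apply continuous_on_clamp.
  - apply (continuous_C_inv (fun x => k (clamp b x))).
    + now apply continuous_on_clamp.
    + now apply Hk0, clamp_segment.
Qed.

Lemma C2_on_quotients_continuous (b : R) (f f' f'' : R -> C) :
  0 < b -> C2_on b f f' f'' -> (forall x, segment b x -> f x <> RtoC 0) ->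
  continuous_on (T := R_UniformSpace) (U := C_R_NormedModule) (segment b)
    (fun x => (f' x / f x)%C) /\
  continuous_on (T := R_UniformSpace) (U := C_R_NormedModule) (segment b) (q_of f f'') /\
  continuous_on (T := R_UniformSpace) (U := C_R_NormedModule) (segment b) (q_of_inv f f' f'').
Proof.
  intros Hb Hf Hf0.
  destruct (C2_on_extension b f f' f'' Hb Hf) as (F0 & F1 & F0_cont & F1_cont & HF).
  assert (f_cont : continuous_on (T := R_UniformSpace) (U := C_R_NormedModule) (segment b) f).
  { apply (continuous_on_ext (segment b) F0); [intros x Hx; symmetry; now apply HF|].
    apply continuous_on_forall. intros x _. apply F0_cont. }
  assert (f'_cont : continuous_on (T := R_UniformSpace) (U := C_R_NormedModule) (segment b) f').
  { apply (continuous_on_ext (segment b) F1); [intros x Hx; symmetry; now apply HF|].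
    apply continuous_on_forall. intros x _. apply F1_cont. }
  assert (p_cont := continuous_on_segment_Cdiv b f' f Hb Hf0 f'_cont f_cont).
  assert (q_cont := continuous_on_segment_Cdiv b f'' f Hb Hf0 (proj2 Hf) f_cont).
  split; [exact p_cont|]. split; [exact q_cont|].
  apply continuous_on_segment_of_clamp. intros x.
  assert (px := continuous_on_clamp b _ x Hb p_cont).
  assert (qx := continuous_on_clamp b _ x Hb q_cont).
  apply (continuous_plus (V := C_R_NormedModule)).
  - now apply (continuous_opp (V := C_R_NormedModule)).
  - apply continuous_C_mult; [apply continuous_const|]. now apply continuous_C_mult.
Qed.

(** * The first-order system and the Vekua equation *)

(** With [F0] and [F1] extending [f] and [f'] as in [C2_on_extension], the defects
    E = F0 (G1_u + G2_u) - F1 (G1 - G2) and F = F0 (G1_v - G2_v) - F1 (G1 + G2)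
    solve E_v = p (E - F), F_u = p (F - E)
    and vanish on the respective axes. *)
Lemma characteristic_system (b : R) (f f' f'' : R -> C)
    (H1 G1 G1u G1v H2 G2 G2u G2v : R -> R -> C) :
  0 < b -> C2_on b f f' f'' -> (forall x, segment b x -> f x <> RtoC 0) -> f 0 = RtoC 1 ->
  Goursat_extension b (q_of f f'') (f' 0) H1 G1 G1u G1v ->
  Goursat_extension b (q_of_inv f f' f'') (- f' 0)%C H2 G2 G2u G2v ->
  forall u v, diamond b u v ->
    (G1u u v + G2u u v = f' (u + v)%R / f (u + v)%R * (G1 u v - G2 u v))%C /\
    (G1v u v - G2v u v = f' (u + v)%R / f (u + v)%R * (G1 u v + G2 u v))%C.
Proof.
  intros Hb Hf Hf0 Hf1 X1 X2.
  destruct (C2_on_quotients_continuous b f f' f'' Hb Hf Hf0) as [Hp _].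
  destruct (C2_on_extension b f f' f'' Hb Hf) as (F0 & F1 & F0_cont & F1_cont & HF).
  assert (F0_eq : forall x, segment b x -> f x = F0 x) by (intros x Hx; now apply HF).
  assert (F1_eq : forall x, segment b x -> f' x = F1 x) by (intros x Hx; now apply HF).
  assert (F0_der : forall x, segment b x -> is_derive (V := C_R_NormedModule) F0 x (f' x))
    by (intros x Hx; now apply HF).
  assert (F1_der : forall x, segment b x -> is_derive (V := C_R_NormedModule) F1 x (f'' x))
    by (intros x Hx; now apply HF).
  assert (F0_neq0 : forall x, segment b x -> F0 x <> RtoC 0).
  { intros x Hx. rewrite <- F0_eq by exact Hx. now apply Hf0. }
  set (p := fun x => (f' x / f x)%C).
  destruct (continuous_2d_bounded (fun u _ => p (clamp b u)) b) as (M & HM & Hpm).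
  { intros q. apply (continuous_comp fst (fun x => p (clamp b x)));
      [destruct q; apply continuous_fst|]. now apply continuous_on_clamp. }
  assert (p_le : forall x, segment b x -> Cmod (p x) <= M).
  { intros x Hx. rewrite <- (clamp_id b x Hx). apply Hpm with (y := 0).
    - exact Hx.
    - rewrite Rabs_R0. lra. }
  assert (D1 := ext_diff _ _ _ _ _ _ _ X1). assert (D2 := ext_diff _ _ _ _ _ _ _ X2).
  set (S := fun u v => (G1 u v + G2 u v)%C). set (D := fun u v => (G1 u v - G2 u v)%C).
  set (E := fun u v => (F0 (u + v)%R * (G1u u v + G2u u v) - F1 (u + v)%R * D u v)%C).
  set (F := fun u v => (F0 (u + v)%R * (G1v u v - G2v u v) - F1 (u + v)%R * S u v)%C).
  assert (E_v : forall u v, diamond b u v -> is_derive (V := C_R_NormedModule) (fun w => E u w) v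
    (p (u + v)%R * (E u v - F u v))%C).
  { intros u v Huv. assert (Hx : segment b (u + v)) by apply (diamond_square _ _ _ Huv).
    eapply is_derive_C_eq.
    - apply is_derive_C_minus; apply is_derive_C_mult.
      + exact (proj1 (is_derive_C_shift F0 u v _ (F0_der _ Hx))).
      + apply is_derive_C_plus; [exact (proj1 (ext_uv _ _ _ _ _ _ _ X1 u v Huv))|
          exact (proj1 (ext_uv _ _ _ _ _ _ _ X2 u v Huv))].
      + exact (proj1 (is_derive_C_shift F1 u v _ (F1_der _ Hx))).
      + apply is_derive_C_minus; [exact (differentiable_2d_partial_r _ _ _ _ _ (D1 u v))|
          exact (differentiable_2d_partial_r _ _ _ _ _ (D2 u v))].
    - unfold E, F, S, D, p, q_of_inv, q_of.
      rewrite F0_eq, F1_eq by exact Hx. cbv beta.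
      field. now apply F0_neq0. }
  assert (F_u : forall u v, diamond b u v -> is_derive (V := C_R_NormedModule) (fun s => F s v) u
    (p (u + v)%R * (F u v - E u v))%C).
  { intros u v Huv. assert (Hx : segment b (u + v)) by apply (diamond_square _ _ _ Huv).
    eapply is_derive_C_eq.
    - apply is_derive_C_minus; apply is_derive_C_mult.
      + exact (proj2 (is_derive_C_shift F0 u v _ (F0_der _ Hx))).
      + apply is_derive_C_minus; [exact (proj2 (ext_uv _ _ _ _ _ _ _ X1 u v Huv))|
          exact (proj2 (ext_uv _ _ _ _ _ _ _ X2 u v Huv))].
      + exact (proj2 (is_derive_C_shift F1 u v _ (F1_der _ Hx))).
      + apply is_derive_C_plus; [exact (differentiable_2d_partial_l _ _ _ _ _ (D1 u v))|
          exact (differentiable_2d_partial_l _ _ _ _ _ (D2 u v))].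
    - unfold E, F, S, D, p, q_of_inv, q_of.
      rewrite F0_eq, F1_eq by exact Hx. cbv beta.
      field. now apply F0_neq0. }
  assert (F_0 : forall v, F 0 v = RtoC 0).
  { intros v. unfold F, S.
    rewrite (ext_0v _ _ _ _ _ _ _ X1), (ext_0v _ _ _ _ _ _ _ X2),
      (ext_v_0v _ _ _ _ _ _ _ X1), (ext_v_0v _ _ _ _ _ _ _ X2).
    unfold Cdiv. ring. }
  assert (G1_cont := differentiable_continuous_2d _ _ _ D1).
  assert (G2_cont := differentiable_continuous_2d _ _ _ D2).
  (* On the axis v = 0, S_u = (q_f + q_{1/f})/2 = p^2, so that E = - p y there with
     y = f D - f'.  As D_u = (q_f - q_{1/f})/2 = f''/f - p^2, this y solves
     y' = p y, and y(0) = 0 because D(0, 0) = f'(0). *)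
  assert (D_0 : forall u, segment b u -> (F0 u * D u 0 - F1 u)%C = RtoC 0).
  { apply (linear_ode_zero b M p); [exact HM|exact p_le|..].
    - intros u. apply (continuous_minus (V := C_R_NormedModule)); [|apply F1_cont].
      apply (continuous_C_mult F0 (fun u => D u 0)); [apply F0_cont|].
      apply (continuous_minus (V := C_R_NormedModule));
        [apply (continuous_2d_comp G1 (fun u => u) (fun _ => 0))|
         apply (continuous_2d_comp G2 (fun u => u) (fun _ => 0))];
        try assumption; first [apply continuous_id|apply continuous_const].
    - intros u Hu. eapply is_derive_C_eq.
      + apply is_derive_C_minus; [apply is_derive_C_mult|].
        * exact (F0_der u Hu).
        * apply is_derive_C_minus; [exact (differentiable_2d_partial_l _ _ _ _ _ (D1 u 0))|
            exact (differentiable_2d_partial_l _ _ _ _ _ (D2 u 0))].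
        * exact (F1_der u Hu).
      + rewrite (ext_u_u0 _ _ _ _ _ _ _ X1 u Hu), (ext_u_u0 _ _ _ _ _ _ _ X2 u Hu).
        unfold D, p, q_of_inv, q_of. rewrite F0_eq, F1_eq by exact Hu. cbv beta.
        field. now apply F0_neq0.
    - assert (H0 : segment b 0) by (unfold segment; rewrite Rabs_R0; lra).
      unfold D. rewrite (ext_0v _ _ _ _ _ _ _ X1), (ext_0v _ _ _ _ _ _ _ X2).
      rewrite <- F0_eq, <- F1_eq, Hf1 by exact H0. field. }
  assert (E_0 : forall u, segment b u -> E u 0 = RtoC 0).
  { intros u Hu. unfold E. rewrite Rplus_0_r.
    rewrite (ext_u_u0 _ _ _ _ _ _ _ X1 u Hu), (ext_u_u0 _ _ _ _ _ _ _ X2 u Hu).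
    transitivity (- p u * (F0 u * D u 0 - F1 u))%C; [|rewrite D_0 by exact Hu; ring].
    unfold p, q_of_inv, q_of. rewrite F0_eq, F1_eq by exact Hu. field.
    now apply F0_neq0. }
  assert (F0_sum := continuous_2d_sum _ F0_cont). assert (F1_sum := continuous_2d_sum _ F1_cont).
  assert (E_cont : continuous_2d E).
  { intros q. apply (continuous_minus (V := C_R_NormedModule)); apply continuous_C_mult.
    - apply F0_sum.
    - apply (continuous_plus (V := C_R_NormedModule));
        [apply (ext_cont_u _ _ _ _ _ _ _ X1)|apply (ext_cont_u _ _ _ _ _ _ _ X2)].
    - apply F1_sum.
    - apply (continuous_minus (V := C_R_NormedModule)); [apply G1_cont|apply G2_cont]. }
  assert (F_cont : continuous_2d F).
  { intros q. apply (continuous_minus (V := C_R_NormedModule)); apply continuous_C_mult.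
    - apply F0_sum.
    - apply (continuous_minus (V := C_R_NormedModule));
        [apply (ext_cont_v _ _ _ _ _ _ _ X1)|apply (ext_cont_v _ _ _ _ _ _ _ X2)].
    - apply F1_sum.
    - apply (continuous_plus (V := C_R_NormedModule)); [apply G1_cont|apply G2_cont]. }
  destruct (continuous_2d_bounded E b E_cont) as (BE & HBE & E_le).
  destruct (continuous_2d_bounded F b F_cont) as (BF & HBF & F_le).
  assert (Hzero : forall u v, diamond b u v -> E u v = RtoC 0 /\ F u v = RtoC 0).
  { apply (Goursat_system_zero b M (BE + BF) E F (fun u v => p (u + v)%R * (E u v - F u v))%C
      (fun u v => p (u + v)%R * (F u v - E u v))%C HM); [lra| | |].
    - intros u v Huv. assert (Hx : segment b (u + v)) by apply (diamond_square _ _ _ Huv).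
      assert (Hu : Rabs u <= b) by apply (diamond_hexagon _ _ _ Huv).
      assert (Hv : Rabs v <= b) by apply (diamond_hexagon _ _ _ Huv).
      assert (Hsub : forall z w : C, Cmod (p (u + v)%R * (z - w)) <= M * (Cmod z + Cmod w)).
      { intros z w. rewrite Cmod_mult.
        apply Rmult_le_compat; [apply Cmod_ge_0..|now apply p_le|].
        rewrite <- (Cmod_opp w). apply Cmod_triangle. }
      specialize (E_le u v Hu Hv). specialize (F_le u v Hu Hv).
      refine (conj _ (conj _ (conj _ (conj _ (conj _ _)))));
        [now apply E_v|now apply F_u|apply Hsub| |lra|lra].
      rewrite (Rplus_comm (Cmod (E u v))). apply Hsub.
    - intros u Hu. apply E_0. unfold diamond in Hu. rewrite Rabs_R0, Rplus_0_r in Hu. exact Hu.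
    - intros v _. apply F_0. }
  intros u v Huv. assert (Hx : segment b (u + v)) by apply (diamond_square _ _ _ Huv).
  destruct (Hzero u v Huv) as [E0 F_eq0].
  rewrite F0_eq, F1_eq by exact Hx. split.
  - transitivity (E u v / F0 (u + v)%R + F1 (u + v)%R / F0 (u + v)%R * (G1 u v - G2 u v))%C.
    + unfold E, D. field. now apply F0_neq0.
    + rewrite E0. field. now apply F0_neq0.
  - transitivity (F u v / F0 (u + v)%R + F1 (u + v)%R / F0 (u + v)%R * (G1 u v + G2 u v))%C.
    + unfold F, S. field. now apply F0_neq0.
    + rewrite F_eq0. field. now apply F0_neq0.
Qed.

Theorem theorem7p1 (b : R) (f f' f'' : R -> C) (Hf Hinvf : R -> R -> C)
    (b_pos : (0 < b)%R)
    (f_C2 : C2_on b f f' f'')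
    (f_neq0 : forall x : R, segment b x -> f x <> RtoC 0)
    (f_at0 : f 0%R = RtoC 1)
    (Hf_sol : goursat_solution b (q_of f f'') (f' 0%R) Hf)
    (Hinvf_sol : goursat_solution b (q_of_inv f f' f'') (- f' 0%R)%C Hinvf) :
  vekua_solution b (fun x : R => (f' x / (2 * f x))%C)
    (fun x t : R =>
       Bminus (CtoB (kernel Hf x t)) (Bmult Bj (CtoB (kernel Hinvf x t)))).
Proof.
  destruct (C2_on_quotients_continuous b f f' f'' b_pos f_C2 f_neq0) as (_ & q_cont & qinv_cont).
  destruct (Goursat_extension_exists b _ _ _ b_pos q_cont Hf_sol) as (G1 & G1u & G1v & X1).
  destruct (Goursat_extension_exists b _ _ _ b_pos qinv_cont Hinvf_sol) as (G2 & G2u & G2v & X2).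
  assert (Hsys := characteristic_system b f f' f'' _ _ _ _ _ _ _ _ b_pos f_C2 f_neq0 f_at0 X1 X2).
  destruct X1 as [c1u c1v d1 e1 _ _ _ _]. destruct X2 as [c2u c2v d2 e2 _ _ _ _].
  assert (half_cont : forall g k : R -> R -> C, continuous_2d g -> continuous_2d k ->
    continuous_2d (fun x t => ((kernel g x t + kernel k x t) / 2)%C) /\
    continuous_2d (fun x t => ((kernel g x t - kernel k x t) / 2)%C)).
  { intros g k Hg%continuous_2d_kernel Hk%continuous_2d_kernel.
    split; intros p; (apply continuous_C_mult; [|apply continuous_const]).
    - apply (continuous_plus (V := C_R_NormedModule)); [apply Hg|apply Hk].
    - apply (continuous_minus (V := C_R_NormedModule)); [apply Hg|apply Hk]. }
  assert (pair_cont : forall g k : R -> R -> C, continuous_2d g -> continuous_2d k ->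
    continuous_on (T := prod_UniformSpace R_UniformSpace R_UniformSpace)
      (U := Bicomplex_R_NormedModule) (fun p => square b (fst p) (snd p))
      (fun p => (g (fst p) (snd p), - k (fst p) (snd p))%C)).
  { intros g k Hg Hk. apply continuous_on_forall. intros p _.
    apply (continuous_pair (U := C_R_NormedModule) (V := C_R_NormedModule)); [apply Hg|].
    apply (continuous_opp (V := C_R_NormedModule)), Hk. }
  exists (fun x t => ((kernel G1u x t + kernel G1v x t) / 2,
                      - ((kernel G2u x t + kernel G2v x t) / 2))%C).
  exists (fun x t => ((kernel G1u x t - kernel G1v x t) / 2,
                      - ((kernel G2u x t - kernel G2v x t) / 2))%C).
  split; [exact (pair_cont _ _ (proj1 (half_cont _ _ c1u c1v)) (proj1 (half_cont _ _ c2u c2v)))|].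
  split; [exact (pair_cont _ _ (proj2 (half_cont _ _ c1u c1v)) (proj2 (half_cont _ _ c2u c2v)))|].
  assert (W_eq : forall x t, square b x t -> (kernel G1 x t, - kernel G2 x t)%C =
    Bminus (CtoB (kernel Hf x t)) (Bmult Bj (CtoB (kernel Hinvf x t)))).
  { intros x t Hxt%square_diamond. unfold kernel. rewrite <- e1, <- e2 by exact Hxt.
    unfold Bminus, Bmult, CtoB, Bj. simpl fst; simpl snd. f_equal; ring. }
  intros x t [Hx Ht].
  destruct (is_derive_kernel G1 G1u G1v x t d1) as [d1x d1t].
  destruct (is_derive_kernel G2 G2u G2v x t d2) as [d2x d2t].
  split; [|split].
  - apply (is_derive_is_derive_on (V := Bicomplex_R_NormedModule) (segment b)
      (fun s => (kernel G1 s t, - kernel G2 s t)%C)); [exact Hx| |].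
    + intros s Hs. apply W_eq. now split.
    + apply (is_derive_pair (U := C_R_NormedModule) (V := C_R_NormedModule)); [exact d1x|].
      now apply is_derive_C_opp.
  - apply (is_derive_is_derive_on (V := Bicomplex_R_NormedModule) (segment b)
      (fun s => (kernel G1 x s, - kernel G2 x s)%C)); [exact Ht| |].
    + intros s Hs. apply W_eq. now split.
    + apply (is_derive_pair (U := C_R_NormedModule) (V := C_R_NormedModule)); [exact d1t|].
      now apply is_derive_C_opp.
  - rewrite <- W_eq by now split.
    destruct (Hsys _ _ (square_diamond b x t (conj Hx Ht))) as [Hu Hv].
    replace ((x + t) / 2 + (x - t) / 2) with x in Hu, Hv by field.
    unfold dbar, Bminus, Bmult, Bconj, CtoB, Bj. cbn [fst snd]. unfold kernel.
    set (u := (x + t) / 2) in *. set (v := (x - t) / 2) in *.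
    assert (Hu' : G1u u v = (f' x / f x * (G1 u v - G2 u v) - G2u u v)%C) by (rewrite <- Hu; ring).
    assert (Hv' : G1v u v = (f' x / f x * (G1 u v + G2 u v) + G2v u v)%C) by (rewrite <- Hv; ring).
    rewrite Hu', Hv'. f_equal; field; now apply f_neq0.
Qed.
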